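(* Let $T=(T_0,T_1,T_2)$ be a finite triangulation of the sphere $S^2$, and let $\Gamma=(\gamma_0,\gamma_1,\dots,\gamma_{n-1},\gamma_0)$ be a 2-loop in $T$, with base path $\gamma_0$. If $\Gamma$ sweeps each triangle of $T$ once only, then the trace of the 2-holonomy $\varphi_\Gamma$ of the chromatic stack $\varphi$ along $\Gamma$, evaluated in the representation $\varphi_{\gamma_0}=V^{\otimes \ell_0}$ associated to the base path $\gamma_0$ of $\Gamma$ (where $\ell_0$ is the length of $\gamma_0$), is the chromatic index of $T$: $$\mathrm{tr}_{\varphi_{\gamma_0}}(\varphi_\Gamma)=K_T .$$
   Context: Triangulation. $T_0,T_1,T_2$ are the sets of vertices, (unoriented) edges and triangles of $T$. An orientation of $S^2$ is fixed, and $[xyz]$ denotes a positively oriented triangle. Chromatic index. $K_T:=\sum_u\prod_{[xyz]} i\,\det(u_{xy},u_{yz},u_{zx})$, where $i=\sqrt{-1}$, $u$ runs over all maps $T_1\to\{e_1,e_2,e_3\}$ (the canonical basis of $\mathbb{R}^3$), and the product is over all positively oriented triangles $[xyz]$ of $T$ (one factor for each triangle). Edge-paths, 2-paths, 2-loops. An edge-path is a sequence $\gamma=(x_0,\dots,x_\ell)$, $\ell\geq 0$, of vertices with $\{x_j,x_{j+1}\}\in T_1$ for all $j$; its length is $|\gamma|=\ell$. A 2-edge is a pair of edge-paths of the form $\{(x_0,\dots,x_\ell),(x_0,\dots,x_j,y,x_{j+1},\dots,x_\ell)\}$ with $\{x_j,y,x_{j+1}\}\in T_2$ (a triangle); we say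 that this 2-edge sweeps the triangle $\{x_j,y,x_{j+1}\}$. A 2-path is a sequence $\Gamma=(\gamma_0,\dots,\gamma_n)$ of edge-paths such that each $\{\gamma_p,\gamma_{p+1}\}$ is a 2-edge. It is a 2-loop based at $\gamma_0$ (its base path) if $\gamma_n=\gamma_0$. It sweeps each triangle once only if each triangle of $T$ is swept by $\{\gamma_p,\gamma_{p+1}\}$ for exactly one $p\in\{0,\dots,n-1\}$. Representation. $V=\mathfrak{sl}_2(\mathbb{C})$, the complexification of $\mathfrak{so}_3\simeq\mathbb{R}^3$, viewed as its adjoint representation, with basis $e_1,e_2,e_3$ and bracket $[e_a,e_b]=i\,\varepsilon_{abc}e_c$ (sum over $c$; $\varepsilon$ the Levi-Civita symbol). $I=\mathrm{Id}_V$, and $V^{\otimes 0}=\mathbb{C}$. Define $\mathfrak{sl}_2$-equivariant maps $$\widetilde F:V\otimes V\to V,\quad \widetilde F(e_a\otimes e_b)=[e_a,e_b]=i\,\varepsilon_{abc}e_c,\qquad F:V\to V\otimes V,\quad F(e_a)=i\,e_{a-1}\wedge e_{a+1},$$ with indices modulo 3 and $u\wedge v=u\otimes v-v\otimes u$ (so $\widetilde F F=2I$). Chromatic stack. To an edge-path $\gamma$ of length $\ell$ the chromatic stack $\varphi$ associates the functor $\varphi_\gamma=V^{\otimes\ell}\otimes-$ on the category of finite-dimensional complex representations of $\mathfrak{sl}_2$, identified with the representation $V^{\otimes \ell}$. To an ordered pair $(\gamma,\gamma')$ forming a 2-edge it associates a natural transformation $\varphi_{\gamma\gamma'}:\varphi_{\gamma'}\to\varphi_\gamma$,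 given by an intertwiner $V^{\otimes|\gamma'|}\to V^{\otimes|\gamma|}$, as follows. If $\gamma=(x_0,\dots,x_j,y,x_{j+1},\dots,x_\ell)$ and $\gamma'=(x_0,\dots,x_\ell)$, then $\varphi_{\gamma\gamma'}=I^{\otimes j}\otimes F\otimes I^{\otimes(\ell-j-1)}$. If $\gamma=(x_0,\dots,x_\ell)$ and $\gamma'=(x_0,\dots,x_j,y,x_{j+1},\dots,x_\ell)$, then $\varphi_{\gamma\gamma'}=I^{\otimes j}\otimes\widetilde F\otimes I^{\otimes(\ell-j-1)}$. 2-holonomy. For a 2-loop $\Gamma=(\gamma_0,\gamma_1,\dots,\gamma_{n-1},\gamma_0)$ based at $\gamma_0$, the 2-holonomy of $\varphi$ along $\Gamma$ is the natural transformation $\varphi_\Gamma=\varphi_{\gamma_0\gamma_1}\circ\varphi_{\gamma_1\gamma_2}\circ\cdots\circ\varphi_{\gamma_{n-1}\gamma_0}:\varphi_{\gamma_0}\to\varphi_{\gamma_0}$, i.e. an endomorphism of $V^{\otimes\ell_0}$, where $\ell_0=|\gamma_0|$.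
   Formalization: Adds the hypothesis that the edge-paths of the 2-loop do not all start with the same edge and do not all end with the same edge; otherwise that edge is never swept and multiplies the trace by dim V = 3 (tetrahedron: 18 instead of K_T = 6). *)

(* Defs.v *)
From HB Require Import structures.
From mathcomp Require Import all_boot all_order all_algebra.
From mathcomp Require Import complex mxtens.
From mathcomp Require Import all_classical all_reals all_analysis.

Set Implicit Arguments.
Unset Strict Implicit.
Unset Printing Implicit Defensive.

Import Order.TTheory GRing.Theory Num.Theory.
Import numFieldNormedType.Exports.

Local Open Scope ring_scope.
Local Open Scope complex_scope.

(* The set of vertices is the whole finite type T0. *)
Record tricomplex (T0 : finType) := TriComplex {
  edges : {set {set T0}};
  triangles : {set {set T0}};
  card_edge : forall e, e \in edges -> #|e| = 2%N;
  card_triangle : forall t, t \in triangles -> #|t| = 3%N;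
  edge_of_triangle : forall (t e : {set T0}),
    t \in triangles -> e \subset t -> #|e| = 2%N -> e \in edges
}.

Section Sphere.
Local Open Scope classical_set_scope.
Variables (R : realType) (T0 : finType) (T : tricomplex T0).

Definition is_simplex (s : {set T0}) : bool :=
  [|| #|s| == 1%N, s \in edges T | s \in triangles T].

(* Points are given by their barycentric coordinates. *)
Definition realization : set {ptws T0 -> R} :=
  [set p | [/\ forall x, 0 <= p x, \sum_x p x = 1
             & is_simplex (finset (fun x => p x != 0))]].

Definition unit_sphere : set 'rV[R]_3 :=
  [set p | \sum_(k < 3) p ord0 k ^+ 2 = 1].

Definition triangulates_sphere : Prop :=
  exists (f : {ptws T0 -> R} -> 'rV[R]_3) (g : 'rV[R]_3 -> {ptws T0 -> R}),
    [/\ {within realization, continuous f},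
        {within unit_sphere, continuous g},
        (forall p, realization p -> unit_sphere (f p) /\ g (f p) = p)
      & (forall q, unit_sphere q -> realization (g q) /\ f (g q) = q)].

End Sphere.

Section Triangulation.
Variables (T0 : finType) (T : tricomplex T0).

(* pos x y z reads "[xyz] is a positively oriented triangle". Two distinct
   triangles with a common edge induce opposite directions on it; on a
   triangulated sphere exactly two relations pos satisfy these conditions, one
   for each orientation of the sphere. *)
Definition is_orientation (pos : T0 -> T0 -> T0 -> bool) : Prop :=
  [/\ forall x y z, pos x y z -> [set x; y; z]%SET \in triangles T,
      forall x y z, pos x y z -> pos y z x,
      forall x y z, [set x; y; z]%SET \in triangles T ->
        pos x y z = ~~ pos y x z
    & forall x y z w, pos x y z -> [set x; y; w]%SET \in triangles T ->
        w != z -> pos y x w].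

(* The path (x_0, ..., x_l) is the list of its l.+1 vertices. *)
Definition edge_path (g : seq T0) : bool :=
  if g is x :: p then path (fun y z => [set y; z]%SET \in edges T) x p
  else false.

Definition plength (g : seq T0) : nat := (size g).-1.

(* h is g with a vertex y inserted between x_j and x_{j+1}, and
   t = {x_j, y, x_{j+1}} is a triangle. *)
Definition inserts (g h : seq T0) (j : nat) (t : {set T0}) : bool :=
  [&& (j < plength g)%N, t \in triangles T &
   [exists y, (t == [set nth y g j; y; nth y g j.+1]%SET)
           && (h == take j.+1 g ++ y :: drop j.+1 g)]].

Definition sweeps (g h : seq T0) (t : {set T0}) : bool :=
  [exists j : 'I_(plength g), inserts g h j t] ||
  [exists j : 'I_(plength h), inserts h g j t].

Definition two_edge (g h : seq T0) : bool := [exists t, sweeps g h t].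

Definition two_path (g0 : seq T0) (s : seq (seq T0)) : bool :=
  all edge_path (g0 :: s) && path two_edge g0 s.

Definition sweeps_each_triangle_once (g0 : seq T0) (s : seq (seq T0)) : Prop :=
  forall t, t \in triangles T ->
    #|[set p : 'I_(size s) |
        sweeps (nth [::] (g0 :: s) p) (nth [::] (g0 :: s) p.+1) t]%SET| = 1%N.

(* Excludes 2-paths all of whose paths start with the same edge, or all end
   with the same edge. Attaching such an edge to all the paths of a 2-loop
   tensors its 2-holonomy with the identity of V, hence multiplies the trace
   by dim V = 3. *)
Definition whiskerless (g0 : seq T0) (s : seq (seq T0)) : Prop :=
  (forall x y, ~~ all (prefix [:: x; y]) (g0 :: s)) /\
  (forall x y, ~~ all (suffix [:: x; y]) (g0 :: s)).

End Triangulation.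

Section ChromaticStack.
Variable R : realType.
Local Notation C := R[i].

(* V = C^3 in the basis e_1, e_2, e_3, here indexed by 'I_3, whose arithmetic
   is modulo 3. *)
Definition bvec (a : 'I_3) : 'cV[C]_3 := delta_mx a 0.

Definition det3 (u v w : 'cV[C]_3) : C := \det (row_mx u (row_mx v w)).

Definition levi_civita (a b c : 'I_3) : C := det3 (bvec a) (bvec b) (bvec c).

Definition bracket (a b : 'I_3) : 'cV[C]_3 :=
  'i *: \sum_c levi_civita a b c *: bvec c.

Definition wedge (u v : 'cV[C]_3) : 'cV[C]_(3 * 3) := (u *t v) - (v *t u).

(* Linear maps act on column vectors; w *m u^T sends u to w and kills the
   other vectors of the standard basis. *)
Definition Ftilde : 'M[C]_(3, 3 * 3) :=
  \sum_a \sum_b bracket a b *m (bvec a *t bvec b)^T.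

Definition F : 'M[C]_(3 * 3, 3) :=
  \sum_a ('i *: wedge (bvec (a - 1)) (bvec (a + 1))) *m (bvec a)^T.

Variables (T0 : finType) (T : tricomplex T0).

Definition tdim (g : seq T0) : nat := (3 ^ plength g)%N.

(* phi g h is the map V^{(x)|h|} -> V^{(x)|g|}. The index j of an insertion is
   unique because a triangle has distinct vertices. In both cases the
   dimensions on the two sides of conform_mx are equal, for instance
   3^j * (3 * 3) * 3^(l - j - 1) = 3^(l + 1) with l = |h| in the first one, so
   conform_mx is then a cast; the Kronecker product orders the basis
   lexicographically, so that this cast is the canonical identification. *)
Definition phi (g h : seq T0) : 'M[C]_(tdim g, tdim h) :=
  if [pick j : 'I_(plength h) | [exists t, inserts T h g j t]] is Some j then
    conform_mx 0 ((1%:M : 'M[C]_(3 ^ j)) *t F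
                    *t (1%:M : 'M[C]_(3 ^ (plength h - j - 1))))
  else if [pick j : 'I_(plength g) | [exists t, inserts T g h j t]] is Some j
  then
    conform_mx 0 ((1%:M : 'M[C]_(3 ^ j)) *t Ftilde
                    *t (1%:M : 'M[C]_(3 ^ (plength g - j - 1))))
  else 0.

Fixpoint phi_path (g0 : seq T0) (s : seq (seq T0)) {struct s} :
    'M[C]_(tdim g0, tdim (last g0 s)) :=
  if s is g1 :: s' then phi g0 g1 *m phi_path g1 s' else 1%:M.

Definition holonomy (g0 : seq T0) (s : seq (seq T0)) (loop : last g0 s = g0) :
    'M[C]_(tdim g0) :=
  castmx (erefl, congr1 tdim loop) (phi_path g0 s).

Local Notation coloring := {ffun {e : {set T0} | e \in edges T} -> 'I_3}.

(* The default value 0 is for pairs that are not edges. *)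
Definition edge_vec (u : coloring) (x y : T0) : 'cV[C]_3 :=
  if insub [set x; y]%SET is Some e then bvec (u e) else 0.

(* The determinant is invariant under cyclic permutations, so the choice of one
   of the three positive orderings of the vertices of t is immaterial. *)
Definition triangle_weight (pos : T0 -> T0 -> T0 -> bool) (u : coloring)
    (t : {set T0}) : C :=
  if [pick p : T0 * T0 * T0 |
       pos p.1.1 p.1.2 p.2 && (t == [set p.1.1; p.1.2; p.2]%SET)]
    is Some (x, y, z)
  then 'i * det3 (edge_vec u x y) (edge_vec u y z) (edge_vec u z x)
  else 1.

Definition chromatic_index (pos : T0 -> T0 -> T0 -> bool) : C :=
  \sum_(u : coloring) \prod_(t in triangles T) triangle_weight pos u t.

End ChromaticStack.

(* Main.v *)
Require Import Defs.
From mathcomp Require Import all_boot all_order all_algebra.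
From mathcomp Require Import complex.
From mathcomp Require Import all_classical all_reals all_analysis.
From mathcomp Require Import mxtens zify ring lra.

Set Implicit Arguments.
Unset Strict Implicit.
Unset Printing Implicit Defensive.

Import Order.TTheory GRing.Theory Num.Theory.
Import numFieldNormedType.Exports.

Local Open Scope ring_scope.

(** The composite of the maps of the chromatic stack is expanded in the basis of
the tensor products of the e_a. The trace becomes a sum over the sequences
w_0, ..., w_n = w_0 of words that color the successive arcs of the paths
gamma_0, ..., gamma_n = gamma_0, and each step contributes one coefficient of F
or of Ftilde, that is, plus or minus i times a Levi-Civita symbol of the three
colors on the swept triangle. A term can be nonzero only if an arc keeps its
color until it is swept. The theorem says that these sequences of words are the
colorings of the edges of T ([coloring_of_chain], [coloring_chain_inj]) and that
the signs cancel ([chain_weight_coloring], [prod_sign]).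

Both statements come from one conservation law. Give the triangle swept at step
p the sign + or - according to whether the path crosses it in the direction
prescribed by the orientation. Passing from gamma_p to gamma_(p+1) changes the
path, seen as a 1-chain with colors, by this sign times the oriented boundary of
the triangle ([flow_step]). The path returns to its start, so the signed sum of
the swept triangles is a cycle. The orientation puts at most two triangles on
each edge, with opposite induced directions; hence they come in pairs, swept
with the same sign and with the same color on the common edge
([closed_neighbor]). Counting the three sides of the negatively swept triangles
then shows that their number is even.

It remains to see that an arc of some gamma_p with a color other than that of
its edge cannot exist. It would never be swept, hence would survive at every
step, and would split each path into a left and a right part which are again
closed. The triangles swept on the left form a cycle by themselves, so that none
of them has an edge in common with a triangle swept on the right
([no_eternal]). As the triangles of a sphere are connected through their edges,
one of the two sides is constant, and all the paths start, or end, with the same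
edge, which is excluded.

The topology of the sphere enters only through the fact that a finite set of
points does not separate it ([realization_sign]): a continuous function with
finitely many zeros keeps its sign. Applied to suitable polynomials in the
barycentric coordinates, it shows that every edge lies in a triangle
([edge_in_triangle]) and that the triangles are connected through their edges
([triangles_edge_connected]). *)

(** * Finitely many points do not separate the sphere *)

Section Sphere.
Variable R : realType.
Local Open Scope classical_set_scope.

Lemma continuous_within_comp (U V W : topologicalType) (A : set U) (B : set V)
    (f : U -> V) (g : V -> W) :
  (forall x, A x -> B (f x)) -> {within A, continuous f} ->
  {within B, continuous g} -> {within A, continuous (g \o f)}.
Proof.
move=> AB /subspace_continuousP cf /subspace_continuousP cg.
apply/subspace_continuousP => x Ax.
apply: cvg_trans (cg _ (AB _ Ax)).
move=> P; rewrite /within /= => BP.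
have := cf x Ax _ BP; rewrite /within /nbhs /=.
by apply: filterS => y H Ay; apply: H => //; apply: AB.
Qed.

Definition sqnorm (x : 'rV[R]_3) : R := \sum_(k < 3) x ord0 k ^+ 2.

Lemma sqnorm_ge0 x : 0 <= sqnorm x.
Proof. by apply: sumr_ge0 => k _; apply: sqr_ge0. Qed.

Lemma sqnorm_eq0 x : (sqnorm x == 0) = (x == 0).
Proof.
apply/idP/eqP => [|->]; last first.
  by rewrite /sqnorm big1 // => k _; rewrite mxE expr0n.
rewrite psumr_eq0 => [/allP H|k _]; last exact: sqr_ge0.
apply/rowP => k; have := H k; rewrite mem_index_enum sqrf_eq0 => /(_ isT) /eqP ->.
by rewrite mxE.
Qed.

Definition normalize (x : 'rV[R]_3) : 'rV[R]_3 := (Num.sqrt (sqnorm x))^-1 *: x.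

Lemma normalize_sphere x : x != 0 -> unit_sphere (normalize x).
Proof.
rewrite -sqnorm_eq0 => x0; rewrite /unit_sphere /=.
under eq_bigr do rewrite mxE exprMn.
by rewrite -mulr_sumr -/(sqnorm x) exprVn sqr_sqrtr ?sqnorm_ge0 // mulVf.
Qed.

Lemma normalize_id x : unit_sphere x -> normalize x = x.
Proof. by rewrite /unit_sphere /normalize /sqnorm /= => ->;
  rewrite sqrtr1 invr1 scale1r. Qed.

Lemma normalize_continuous : {within [set x | x != 0], continuous normalize}.
Proof.
apply/subspace_continuousP => x /= x0.
suff cx : {for x, continuous normalize} by move=> P /cx;
  apply: (@filterS _ _ (nbhs_filter x)) => y.
have sx : {for x, continuous sqnorm}.
  have -> : sqnorm = fun y : 'rV[R]_3 => \sum_(k < 3) y ord0 k * y ord0 k.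
    by apply/funext => y; apply: eq_bigr => k _; rewrite expr2.
  have ck k : {for x, continuous (fun y : 'rV[R]_3 => y ord0 k * y ord0 k)}.
    by apply: continuousM; apply: coord_continuous.
  have ac : continuous (fun z : R * R => z.1 + z.2) by exact: add_continuous.
  exact: (@cvg_big R _ +%R 0 xpredT ac _ _ _ _ (fun k => x ord0 k * x ord0 k)
            (nbhs_filter x) (fun k _ => ck k)).
have rx : {for x, continuous (fun y => (Num.sqrt (sqnorm y))^-1)}.
  apply: continuousV.
    by rewrite sqrtr_eq0 -ltNge lt0r sqnorm_eq0 x0 sqnorm_ge0.
  by apply: (@continuous_comp _ _ _ sqnorm Num.sqrt); last exact: sqrt_continuous.
apply: (@cvgZ _ _ _ (nbhs x) _ _ _ _ _ rx); exact: cvg_id.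
Qed.


Lemma common_normal (a b : 'rV[R]_3) :
  exists2 nu : 'cV[R]_3, nu != 0 & a *m nu = 0 /\ b *m nu = 0.
Proof.
pose A := (col_mx a b)^T.
have kA : kermx A != 0.
  rewrite kermx_eq0 /row_free; apply/eqP => rA.
  by have := rank_leq_col A; rewrite rA.
exists (nz_row (kermx A))^T; first by rewrite trmx_eq0 nz_row_eq0.
have /sub_kermxP/(congr1 trmx) : (nz_row (kermx A) <= kermx A)%MS by apply: nz_row_sub.
rewrite trmx_mul trmxK mul_col_mx trmx0 => /eqP; rewrite col_mx_eq0.
by case/andP => /eqP -> /eqP ->.
Qed.

Lemma exists_nonroot (p : {poly R}) : p != 0 -> exists x, ~~ root p x.
Proof.
move=> p0; apply: contrapT => /forallNP rp.
pose rs := [seq (i%:R : R) | i <- iota 0 (size p)].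
have := @max_poly_roots _ p rs p0; rewrite size_map size_iota ltnn.
move=> few; suff: false by []. apply: few.
  by apply/allP => x _; have /negP := rp x; rewrite negbK.
by rewrite map_inj_uniq ?iota_uniq // => i j /eqP; rewrite eqr_nat => /eqP.
Qed.

(** Each pair (a, b) lies in a plane through the origin, and such a plane meets
the moment curve (1, x, x^2) in at most two points. *)
Lemma generic_direction (s : seq ('rV[R]_3 * 'rV[R]_3)) :
  exists v : 'rV[R]_3, forall a b, (a, b) \in s ->
    exists nu : 'cV[R]_3, [/\ a *m nu = 0, b *m nu = 0 & v *m nu != 0].
Proof.
pose curve (x : R) : 'rV[R]_3 := \row_(k < 3) x ^+ k.
suff [p p0 pP] : exists2 p : {poly R}, p != 0 & forall x, ~~ root p x ->
    forall a b, (a, b) \in s -> exists nu : 'cV[R]_3,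
    [/\ a *m nu = 0, b *m nu = 0 & curve x *m nu != 0].
  by have [x px] := exists_nonroot p0; exists (curve x); apply: pP.
elim: s => [|[a b] s [p p0 pP]]; first by exists 1; rewrite ?oner_eq0.
have [nu nu0 [anu bnu]] := common_normal a b.
pose q := \poly_(k < 3) nu (inord k) ord0.
have q0 : q != 0.
  apply: contra nu0 => /eqP q0; apply/eqP/colP => k; rewrite mxE.
  have := coef_poly 3 (fun k => nu (inord k) ord0) k.
  by rewrite -/q q0 coef0 ltn_ord inord_val.
exists (q * p); first by rewrite mulf_neq0.
move=> x; rewrite rootM negb_or => /andP[qx px] a' b';
  rewrite inE => /orP[/eqP[-> ->]|].
  exists nu; split=> //; apply: contra qx => /eqP/matrixP/(_ ord0 ord0).
  rewrite !mxE /root horner_poly => E; rewrite -[X in _ == X]E;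
    apply/eqP/eq_bigr => k _.
  by rewrite mxE inord_val mulrC.
exact: pP.
Qed.

(** The intermediate value theorem along the arc from a to v, normalized from the
segment. The hypothesis on v says that v lies outside every plane through the
origin, a and a point n of N, so that the arc could meet N only at a, where h
does not vanish; the case n = a keeps v away from the line of a, and thus the
segment away from the origin. *)
Lemma sphere_arc_sign (h : 'rV[R]_3 -> R) (N : seq 'rV[R]_3) (a v : 'rV[R]_3) :
  {within unit_sphere (R := R), continuous h} ->
  (forall q, unit_sphere q -> h q = 0 -> q \in N) ->
  unit_sphere a -> h a != 0 ->
  (forall n, n \in a :: N ->
    exists nu : 'cV[R]_3, [/\ a *m nu = 0, n *m nu = 0 & v *m nu != 0]) ->
  0 < h a * h (normalize v).
Proof.
move=> ch hN Sa ha vP.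
pose arc (t : R) : 'rV[R]_3 := (1 - t) *: a + t *: v.
have arcM t (nu : 'cV[R]_3) : a *m nu = 0 -> arc t *m nu = t *: (v *m nu).
  by move=> anu; rewrite mulmxDl -!scalemxAl anu scaler0 add0r.
have arc_plane n t : n \in a :: N ->
    (forall nu : 'cV[R]_3, a *m nu = 0 -> n *m nu = 0 -> arc t *m nu = 0) -> t = 0.
  move=> /vP[nu [anu nnu vnu]] /(_ nu anu nnu) /eqP.
  by rewrite arcM // scaler_eq0 (negbTE vnu) orbF => /eqP.
have arc0 : arc 0 = a by rewrite /arc subr0 scale1r scale0r addr0.
have arc1 : arc 1 = v by rewrite /arc subrr scale0r scale1r add0r.
have arc_neq0 t : arc t != 0.
  apply/eqP => tE; have t0 : t = 0.
    by apply: (@arc_plane a); rewrite ?mem_head // => nu _ _; rewrite tE mul0mx.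
  have : sqnorm (arc t) = 1 by rewrite t0 arc0.
  rewrite tE => /eqP; rewrite (_ : sqnorm 0 = 0) ?(eq_sym 0) ?oner_eq0 //.
  by apply/eqP; rewrite sqnorm_eq0.
have c_arc : continuous arc.
  move=> t.
  have c1 : {for t, continuous (fun t : R => (1 - t) *: a)}.
    by apply: continuousZr_tmp; apply: continuousB;
      [exact: cst_continuous|exact: cvg_id].
  have c2 : {for t, continuous (fun t : R => t *: v)}.
    by apply: continuousZr_tmp; exact: cvg_id.
  exact: (continuousD c1 c2).
have c_h : {within `[0, 1], continuous (h \o (@normalize \o arc))}.
  apply: (@continuous_within_comp _ _ _ _ (@unit_sphere R)) ch.
    by move=> t _; apply: normalize_sphere.
  apply: continuous_within_comp (normalize_continuous); first by move=> t _;
    apply: arc_neq0.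
  exact: continuous_subspaceT.
rewrite ltNge; apply/negP => le0.
have /(IVT ler01 c_h)[t _] : Num.min ((h \o (@normalize \o arc)) 0)
  ((h \o (@normalize \o arc)) 1)
    <= 0 <= Num.max ((h \o (@normalize \o arc)) 0) ((h \o (@normalize \o arc)) 1).
  rewrite /= arc0 arc1 normalize_id // ge_min le_max.
  move: le0; case: (ltgtP (h a) 0) ha => // sa _.
    by rewrite nmulr_rle0 // => ->.
  by rewrite pmulr_rle0 // => ->; rewrite orbT.
move=> /= ht; have nN := hN _ (normalize_sphere (arc_neq0 t)) ht.
have t0 : t = 0.
  apply: (@arc_plane (normalize (arc t))); first by rewrite inE nN orbT.
  move=> nu _; rewrite -scalemxAl => /eqP; rewrite scaler_eq0 invr_eq0 sqrtr_eq0 leNgt.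
  by rewrite lt0r sqnorm_ge0 sqnorm_eq0 arc_neq0 /= => /eqP.
by move: ht ha; rewrite t0 arc0 normalize_id // => ->; rewrite eqxx.
Qed.

(** Two arcs through a common generic direction avoid the need for an arc from a
to b, which would not be determined when b = - a. *)
Lemma sphere_sign (h : 'rV[R]_3 -> R) (N : seq 'rV[R]_3) (a b : 'rV[R]_3) :
  {within unit_sphere (R := R), continuous h} ->
  (forall q, unit_sphere q -> h q = 0 -> q \in N) ->
  unit_sphere a -> unit_sphere b -> 0 < h a -> h b < 0 -> False.
Proof.
move=> ch hN Sa Sb ha hb.
have [v vP] := generic_direction
  ([seq (a, n) | n <- a :: N] ++ [seq (b, n) | n <- b :: N]).
have va : 0 < h a * h (normalize v).
  apply: sphere_arc_sign ch hN Sa (lt0r_neq0 ha) _ => n nN; apply: vP.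
  by rewrite mem_cat (map_f (fun n => (a, n)) nN).
have vb : 0 < h b * h (normalize v).
  apply: sphere_arc_sign ch hN Sb (ltr0_neq0 hb) _ => n nN; apply: vP.
  by rewrite mem_cat (map_f (fun n => (b, n)) nN) orbT.
by move: va vb; rewrite pmulr_rgt0 // nmulr_rgt0 // => /ltW; rewrite leNgt => /negP.
Qed.

Lemma realization_sign (T0 : finType) (T : tricomplex T0)
    (G : {ptws T0 -> R} -> R) (N : seq {ptws T0 -> R}) p q :
  triangulates_sphere R T -> continuous G ->
  (forall r, realization T r -> G r = 0 -> r \in N) ->
  realization T p -> realization T q -> 0 < G p -> G q < 0 -> False.
Proof.
move=> [f [g [cf cg fP gP]]] cG GN rp rq Gp Gq.
have [Sp gp] := fP _ rp; have [Sq gq] := fP _ rq.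
apply: (@sphere_sign (G \o g) [seq f r | r <- N] (f p) (f q)) => //=;
  rewrite ?gp ?gq //.
  apply: (@continuous_within_comp _ _ _ _ setT _ _ _ cg); first by [].
  exact: continuous_subspaceT.
move=> r Sr Gr; have [rg <-] := gP _ Sr.
by apply: map_f; apply: GN.
Qed.

End Sphere.

(** * Edges and triangles of a triangulated sphere *)

Section Realization.
Variables (R : realType) (T0 : finType) (T : tricomplex T0).

Let supp (p : {ptws T0 -> R}) : {set T0} := [set x | p x != 0]%SET.

Definition bary (A : {set T0}) : {ptws T0 -> R} :=
  fun x => if x \in A then #|A|%:R^-1 else 0.

Lemma bary_realization (A : {set T0}) : is_simplex T A -> realization T (bary A).
Proof.
move=> sA; have A0 : (0 < #|A|)%N.
  case/or3P: (sA) => [/eqP -> //|/card_edge -> //|/card_triangle -> //].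
have i0 : #|A|%:R^-1 != 0 :> R by rewrite invr_eq0 pnatr_eq0 -lt0n.
split=> [x||].
- by rewrite /bary; case: ifP => // _; rewrite invr_ge0 ler0n.
- rewrite /bary -big_mkcond /= sumr_const -(mulr_natr _^-1) mulVf //.
  by rewrite pnatr_eq0 -lt0n.
rewrite (_ : finset _ = A) //; apply/setP => x; rewrite inE /bary.
by case: ifP; rewrite ?eqxx ?i0.
Qed.

Lemma eval_continuous (x : T0) : continuous (fun p : {ptws T0 -> R} => p x).
Proof. exact: (@proj_continuous T0 (fun=> R) x). Qed.

(** The middle third of an edge in no triangle would be separated from the rest
of the realization by its two ends. These are the only zeros of p x * p y - 2/9,
which is positive at the middle of the edge and negative at a vertex. *)
Lemma edge_in_triangle (e : {set T0}) :
  triangulates_sphere R T -> e \in edges T ->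
  exists2 t, t \in triangles T & e \subset t.
Proof.
move=> sphereT eT.
have c2 := card_edge eT.
have /cards2P : #|e| == 2%N by apply/eqP.
move=> [x [y [xy eE]]].
case: (pickP (fun t => (t \in triangles T) && (e \subset t))) => [t /andP[tT et]|none].
  by exists t.
exfalso.
pose pt (c : R) : {ptws T0 -> R} :=
  fun z => if z == x then c else if z == y then 1 - c else 0.
(* 2/9 lies below 1/4, the value at the midpoint, and makes the zeros rational. *)
pose G (p : {ptws T0 -> R}) : R := p x * p y - 2 / 9.
have cG : continuous G.
  move=> p; have cxy := continuousM (@eval_continuous x p) (@eval_continuous y p).
  have cc : {for p, continuous (fun _ : {ptws T0 -> R} => 2 / 9 : R)}.
    exact: cst_continuous.
  exact: (continuousB cxy cc).
apply: (@realization_sign R T0 T G [:: pt (1 / 3); pt (2 / 3)] (bary e)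
  (bary [set x]%SET)) => //.
- move=> p [p_ge0 p1 sp] /eqP; rewrite subr_eq0 => /eqP Gp.
  have : p x * p y != 0 by rewrite Gp; apply/eqP; lra.
  rewrite mulf_eq0 negb_or => /andP[px py].
  have es : e \subset supp p.
    by apply/fintype.subsetP => z; rewrite eE !inE => /orP[] /eqP ->.
  have sE : supp p = e.
    case/or3P: sp => [/eqP c1|pe|pt_].
    - by have := subset_leq_card es; rewrite c1 (card_edge eT).
    - by apply/esym/eqP; rewrite eqEcard es (card_edge eT) (card_edge pe).
    by have := none (supp p); rewrite /= pt_ es.
  have p0 z : z != x -> z != y -> p z = 0.
    move=> zx zy; apply/eqP; have : z \notin supp p by rewrite sE eE !inE negb_or zx zy.
    by rewrite inE negbK.
  have py1 : p y = 1 - p x.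
    rewrite -p1 (bigD1 x) //= (bigD1 y) 1?eq_sym //= big1 ?addr0 1?addrC ?addrK //.
    by move=> z /andP[zx zy]; apply: p0.
  have pE c : p x = c -> p = pt c.
    move=> pxc; apply/funext => z; rewrite /pt.
    have [->//|zx] := eqVneq z x; have [->|zy] := eqVneq z y; first by rewrite py1 pxc.
    exact: p0.
  have : (p x - 1 / 3) * (p x - 2 / 3) = 0 by move: Gp; rewrite py1; lra.
  move=> /eqP; rewrite mulf_eq0 !subr_eq0 => /orP[] /eqP /pE ->;
    by rewrite !inE eqxx ?orbT.
- by apply: bary_realization; rewrite /is_simplex eT orbT.
- by apply: bary_realization; rewrite /is_simplex cards1.
- by rewrite /G /bary eE !inE !eqxx orbT cards2 xy /=; lra.
rewrite /G /bary !inE eqxx cards1 eq_sym (negbTE xy) mulr0; lra.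
Qed.

(** The sum of the p x * p y over the edges, with sign + for the edges of the
triangles in A and - for the other edges, vanishes only at the vertices. If no
edge is shared, it is, away from the vertices, positive on the triangles in A
and negative on the other triangles. *)
Lemma triangles_edge_connected (A : {set {set T0}}) t1 t2 :
  triangulates_sphere R T ->
  t1 \in triangles T -> t2 \in triangles T -> t1 \in A -> t2 \notin A ->
  exists t t' x y, [/\ [/\ t \in triangles T, t' \in triangles T,
    t \in A & t' \notin A],
     x != y, [set x; y]%SET \subset t & [set x; y]%SET \subset t'].
Proof.
move=> sphereT t1T t2T t1A t2A.
apply: contrapT => noshare.
pose inA (e : {set T0}) := [exists t, [&& t \in triangles T, t \in A & e \subset t]].
pose chi (e : {set T0}) : R := if inA e then 1 else -1.
pose G (p : {ptws T0 -> R}) : R :=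
  \sum_(xy : T0 * T0 | xy.1 != xy.2) chi [set xy.1; xy.2]%SET * (p xy.1 * p xy.2).
have cG : continuous G.
  move=> p.
  have ac : continuous (fun z : R * R => z.1 + z.2) by exact: add_continuous.
  have ck xy : {for p, continuous (fun p : {ptws T0 -> R} =>
      chi [set xy.1; xy.2]%SET * (p xy.1 * p xy.2))}.
    have cxy := continuousM (@eval_continuous xy.1 p) (@eval_continuous xy.2 p).
    have cc : {for p, continuous (fun _ : {ptws T0 -> R} => chi [set xy.1; xy.2]%SET)}.
      exact: cst_continuous.
    exact: (continuousM cc cxy).
  exact: (@cvg_big R _ +%R 0 _ ac _ _ _ _ _ (nbhs_filter p) (fun k _ => ck k)).
have Gpos p : realization T p -> (1 < #|supp p|)%N ->
    exists2 b : bool, 0 < (-1) ^+ b * G p &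
       forall t, t \in triangles T -> supp p \subset t -> (t \in A) = ~~ b.
  move=> [p0 _ sp] c2.
  have [t tT pt] : exists2 t, t \in triangles T & supp p \subset t.
    case/or3P: sp => [/eqP c1|pe|pt_].
    - by move: c2; rewrite [X in (1 < X)%N]c1.
    - exact: edge_in_triangle.
    by exists (supp p).
  have [x [y [xs ys xy]]] : exists x y, [/\ x \in supp p, y \in supp p & x != y].
    by case/card_gt1P: c2 => x [y []]; exists x, y.
  have same t' x' y' : t' \in triangles T -> x' \in supp p -> y' \in supp p ->
    x' != y' ->
      [set x'; y']%SET \subset t' -> (t' \in A) = (t \in A).
    move=> t'T xp yp xy' et'.
    have et : [set x'; y']%SET \subset t.
      by apply/fintype.subsetP => z; rewrite !inE => /orP[] /eqP ->;
        apply: (fintype.subsetP pt).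
    case: (boolP (t \in A)) => tA; case: (boolP (t' \in A)) => t'A //; case: noshare.
      by exists t, t', x', y'.
    by exists t', t, x', y'.
  have chiE x' y' : x' \in supp p -> y' \in supp p -> x' != y' ->
     chi [set x'; y']%SET = (-1) ^+ (t \notin A).
    move=> xp yp xy'; rewrite /chi;
      case: ifP => [/existsP[t' /and3P[t'T t'A et']]|/existsP nA].
      by rewrite -(same t' x' y') // t'A.
    case tA : (t \in A); last by rewrite expr1.
    case: nA; exists t; rewrite tT tA /=.
    by apply/fintype.subsetP => z; rewrite !inE => /orP[] /eqP ->;
      apply: (fintype.subsetP pt).
  exists (t \notin A); last first.
    move=> t' t'T pt'; rewrite negbK; apply: (same t' x y) => //.
    by apply/fintype.subsetP => z; rewrite !inE => /orP[] /eqP ->;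
      apply: (fintype.subsetP pt').
  have -> : (-1) ^+ (t \notin A) * G p =
    \sum_(xy : T0 * T0 | xy.1 != xy.2) p xy.1 * p xy.2.
    rewrite mulr_sumr; apply: eq_bigr => -[x' y'] /= xy'.
    have [px0|px] := eqVneq (p x') 0; first by rewrite px0 !(mul0r, mulr0).
    have [py0|py] := eqVneq (p y') 0; first by rewrite py0 !(mul0r, mulr0).
    by rewrite chiE ?signrMK ?inE.
  rewrite (bigD1 (x, y)) //= ltr_wpDr //.
    by apply: sumr_ge0 => z _; rewrite mulr_ge0.
  by move: xs ys; rewrite !inE => px py; rewrite mulr_gt0 // lt0r ?px ?py p0.
have suppb t : supp (bary t) = t.
  apply/setP => x; rewrite inE /bary; case: ifP => [xt|]; last by rewrite eqxx.
  by rewrite invr_eq0 pnatr_eq0 cards_eq0; apply/eqP => t0; rewrite t0 inE in xt.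
have tri t : t \in triangles T ->
    realization T (bary t) /\ 0 < (-1) ^+ (t \notin A) * G (bary t).
  move=> tT; have rt : realization T (bary t).
    by apply: bary_realization; rewrite /is_simplex tT !orbT.
  split=> //; have [|b] := Gpos _ rt; first by rewrite suppb (card_triangle tT).
  by rewrite suppb => + /(_ t tT (subxx _)) ->; rewrite negbK.
have [r1 G1] := tri _ t1T; have [r2 G2] := tri _ t2T.
apply: (@realization_sign R T0 T G [seq bary [set x]%SET | x <- enum T0] _ _ sphereT
  cG _ r1 r2).
- move=> p rp Gp; have [c1|/Gpos] := leqP #|supp p| 1; last first.
    by move=> /(_ rp)[b]; rewrite Gp mulr0 ltxx.
  have [p0 p1 _] := rp.
  have /cards1P[x sx] : #|supp p| == 1%N.
    rewrite eqn_leq c1 lt0n cards_eq0; apply: contraT; rewrite negbK => /eqP s0.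
    suff /eqP : 1 = 0 :> R by rewrite oner_eq0.
    rewrite -p1 big1 // => x _; apply/eqP; have : x \notin supp p by rewrite s0 inE.
    by rewrite inE negbK.
  have pz z : z != x -> p z = 0.
    move=> zx; apply/eqP; have : z \notin supp p by rewrite sx inE.
    by rewrite inE negbK.
  have px : p x = 1 by rewrite -p1 (bigD1 x) //= big1 ?addr0 // => z; apply: pz.
  apply/mapP; exists x; first by rewrite mem_enum.
  apply/funext => z; rewrite /bary inE cards1 invr1.
  by case: eqP => [->//|/eqP]; apply: pz.
- by move: G1; rewrite t1A mul1r.
by move: G2; rewrite t2A expr1 mulN1r oppr_gt0.
Qed.
End Realization.

(** * The Levi-Civita symbol and the maps of the chromatic stack *)

Lemma det_mx22 (A : comNzRingType) (M : 'M[A]_2) :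
  \det M = M ord0 ord0 * M (inord 1) (inord 1) - M ord0 (inord 1) * M (inord 1) ord0.
Proof.
rewrite (expand_det_row _ ord0) !big_ord_recl big_ord0 addr0 /cofactor !det_mx11 !mxE
  /=.
rewrite expr0 mul1r expr1 mulN1r mulrN.
by congr (_ * M _ _ - M _ _ * M _ _); apply/val_inj; rewrite /= ?inordK.
Qed.

Lemma det_mx33 (A : comNzRingType) (M : 'M[A]_3) :
  let m i j := M (inord i) (inord j) in
  \det M = m 0%N 0%N * (m 1%N 1%N * m 2%N 2%N - m 1%N 2%N * m 2%N 1%N)
         - m 0%N 1%N * (m 1%N 0%N * m 2%N 2%N - m 1%N 2%N * m 2%N 0%N)
         + m 0%N 2%N * (m 1%N 0%N * m 2%N 1%N - m 1%N 1%N * m 2%N 0%N).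
Proof.
move=> m; rewrite (expand_det_row _ ord0) !big_ord_recl big_ord0 addr0 /cofactor
  !det_mx22.
rewrite !mxE /= expr0 expr1 expr2 mul1r !mulN1r mulrN opprK mul1r addrA.
rewrite /m.
by congr (M _ _ * (M _ _ * M _ _ - M _ _ * M _ _) - M _ _ *
  (M _ _ * M _ _ - M _ _ * M _ _) + M _ _ * (M _ _ * M _ _ - M _ _ * M _ _));
  apply/val_inj; rewrite /= ?inordK.
Qed.

Section LeviCivita.
Variable R : realType.
Local Open Scope complex_scope.
Local Notation C := R[i].
Local Notation eps := (levi_civita R).

Lemma det3_entry (u v w : 'cV[C]_3) i j :
  (row_mx u (row_mx v w)) i j = (nth 0 [:: u; v; w] j) i ord0.
Proof.
rewrite mxE; case: splitP => k /=; first by rewrite (ord1 k) => ->.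
rewrite mxE; case: splitP => l /= ->; rewrite (ord1 l) => -> //.
Qed.

Lemma det3E (u v w : 'cV[C]_3) :
  let x k := u (inord k) ord0 in let y k := v (inord k) ord0 in
  let z k := w (inord k) ord0 in
  det3 u v w = x 0%N * (y 1%N * z 2%N - y 2%N * z 1%N)
    - y 0%N * (x 1%N * z 2%N - x 2%N * z 1%N) + z 0%N * (x 1%N * y 2%N - x 2%N * y 1%N).
Proof.
move=> x y z; rewrite /det3 det_mx33 !det3_entry !inordK //= /x /y /z.
ring.
Qed.

Lemma det3_cyc (u v w : 'cV[C]_3) : det3 v w u = det3 u v w.
Proof. by rewrite !det3E /=; ring. Qed.

Lemma det3_swap (u v w : 'cV[C]_3) : det3 v u w = - det3 u v w.
Proof. by rewrite !det3E /=; ring. Qed.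

Lemma bracketE b c a : bracket R b c a ord0 = 'i * eps b c a.
Proof.
rewrite /bracket mxE; congr (_ * _); rewrite summxE (bigD1 a) //= big1 ?addr0.
  by rewrite !mxE !eqxx mulr1.
by move=> c' /negbTE ca; rewrite !mxE eq_sym ca mulr0.
Qed.

Lemma Ftilde_entry a b c : Ftilde R a (mxtens_index (b, c)) = 'i * eps b c a.
Proof.
rewrite /Ftilde summxE (bigD1 b) //= summxE (bigD1 c) //= !big1 ?addr0 //.
- by rewrite !mxE big_ord1 bracketE !mxE !mxtens_indexK /= !eqxx !mulr1.
- move=> b' /negbTE bb; rewrite summxE big1 // => c' _.
  by rewrite !mxE big_ord1 !mxE !mxtens_indexK /= (eq_sym b) bb !(mul0r, mulr0).
- move=> c' /negbTE cc.
  by rewrite !mxE big_ord1 !mxE !mxtens_indexK /= (eq_sym c) cc !(mul0r, mulr0).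
Qed.

Lemma F_entry a b c : F R (mxtens_index (b, c)) a = - 'i * eps b c a.
Proof.
rewrite /F summxE (bigD1 a) //= big1 ?addr0; last first.
  by move=> a' /negbTE aa; rewrite mxE big_ord1 !mxE (eq_sym a) aa mulr0.
rewrite mxE big_ord1 !mxE !mxtens_indexK /= !eqxx /= mulr1.
rewrite mulNr -mulrN; congr (_ * _).
rewrite /levi_civita det3E !mxE !eqxx !andbT.
case: a => [[|[|[|//]]] ha]; case: b => [[|[|[|//]]] hb]; case: c => [[|[|[|//]]] hc].
all: rewrite -!val_eqE /= ?inordK //=; ring.
Qed.
End LeviCivita.

(** * Matrix entries indexed by words *)

Section Entry.
Variable A : pzRingType.

(** Entries with natural numbers as indices are not affected by casts between
equal dimensions. *)
Definition mx_entry m n (M : 'M[A]_(m, n)) (i j : nat) : A :=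
  oapp (fun i' : 'I_m => oapp (fun j' : 'I_n => M i' j') 0 (insub j)) 0 (insub i).

Lemma mx_entry_ord m n (M : 'M[A]_(m, n)) (i : 'I_m) (j : 'I_n) : mx_entry M i j =
  M i j.
Proof. by rewrite /mx_entry !valK. Qed.

Lemma mx_entry_mul m n p (M : 'M[A]_(m, n)) (N : 'M[A]_(n, p)) i k :
  mx_entry (M *m N) i k = \sum_(j < n) mx_entry M i j * mx_entry N j k.
Proof.
rewrite /mx_entry; case: (insubP _ i) => [i' _ _|_] /=; last by rewrite big1 // => j;
  rewrite mul0r.
case: (insubP _ k) => [k' _ _|_] /=.
  by rewrite mxE; apply: eq_bigr => j _; rewrite valK.
by rewrite big1 // => j _; rewrite !valK /= mulr0.
Qed.

Lemma mx_entry_cast m m' n n' (em : m = m') (en : n = n') (M : 'M[A]_(m, n)) :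
  mx_entry (castmx (em, en) M) = mx_entry M.
Proof. by case: m' / em; case: n' / en; rewrite castmx_id. Qed.

Lemma mx_entry_conform m m' n n' (N : 'M[A]_(m', n')) (M : 'M[A]_(m, n)) :
  m = m' -> n = n' -> mx_entry (conform_mx N M) = mx_entry M.
Proof. by move=> em en; case: m' / em N; case: n' / en => N; rewrite conform_mx_id. Qed.

Lemma mx_entry_tens m n p q (M : 'M[A]_(m, n)) (N : 'M[A]_(p, q)) i1 i2 j1 j2 :
  (i1 < m)%N -> (i2 < p)%N -> (j1 < n)%N -> (j2 < q)%N ->
  mx_entry (tensmx M N) (i1 * p + i2) (j1 * q + j2) =
    mx_entry M i1 j1 * mx_entry N i2 j2.
Proof.
move=> i1m i2p j1n j2q.
have := tensmxE M N (Ordinal i1m) (Ordinal i2p) (Ordinal j1n) (Ordinal j2q).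
by rewrite -(mx_entry_ord (tensmx M N)) -(mx_entry_ord M) -(mx_entry_ord N).
Qed.

Lemma mx_entry_id n i j : (i < n)%N -> (j < n)%N ->
  mx_entry (1%:M : 'M[A]_n) i j = (i == j)%:R.
Proof. by move=> ni nj; rewrite (mx_entry_ord _ (Ordinal ni) (Ordinal nj)) mxE. Qed.
End Entry.

Section Words.

(** The index of the tensor product of the e_a, for a in w, in the lexicographic
order of the Kronecker product. *)
Definition code (w : seq 'I_3) : nat := foldl (fun k (a : 'I_3) => k * 3 + a)%N 0%N w.

Lemma code_cat u v : code (u ++ v) = (code u * 3 ^ size v + code v)%N.
Proof.
elim/last_ind: v => [|v a IH]; first by rewrite cats0 muln1 addn0.
by rewrite -rcons_cat /code !foldl_rcons -/(code (u ++ v)) -/(code v) IH size_rcons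
  expnSr mulnDl mulnA addnA -/(code u).
Qed.

Lemma code_lt w : (code w < 3 ^ size w)%N.
Proof.
elim/last_ind: w => [|w a IH] //.
rewrite /code foldl_rcons -/(code _) size_rcons expnSr; have := ltn_ord a; lia.
Qed.

Lemma code_inj u v : size u = size v -> code u = code v -> u = v.
Proof.
elim/last_ind: u v => [|u a IH] v; first by case: v.
case/lastP: v => [|v b]; rewrite !size_rcons // => -[suv].
rewrite /code !foldl_rcons -/(code u) -/(code v) => E; have := ltn_ord a;
  have := ltn_ord b => hb ha.
have ab : a = b :> nat by lia.
by rewrite (IH v suv) ?(val_inj ab) //; lia.
Qed.

Definition words (l : nat) : seq (seq 'I_3) :=
  [seq val t | t <- enum {: l.-tuple 'I_3}].

Lemma mem_words l w : (w \in words l) = (size w == l).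
Proof.
apply/mapP/idP => [[t _ ->]|sw]; first by rewrite size_tuple.
by exists (Tuple sw); rewrite ?mem_enum.
Qed.

Lemma words_uniq l : uniq (words l).
Proof. by rewrite map_inj_uniq ?enum_uniq //; apply: val_inj. Qed.

Lemma sum_words (A : nmodType) l (f : nat -> A) :
  \sum_(i < 3 ^ l) f i = \sum_(w <- words l) f (code w).
Proof.
have ltl (t : l.-tuple 'I_3) : (code t < 3 ^ l)%N by have := code_lt t;
  rewrite size_tuple.
pose h (t : l.-tuple 'I_3) := Ordinal (ltl t).
have h_inj : injective h.
  by move=> t u /(congr1 val) /= E; apply/val_inj/code_inj; rewrite ?size_tuple.
rewrite /words big_map big_enum /=.
rewrite (reindex h) //; apply: onW_bij; apply: inj_card_bij => //.
by rewrite card_ord card_tuple card_ord.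
Qed.

End Words.

(** * The two kinds of 2-edges *)

Section Phi.
Variables (R : realType) (T0 : finType) (T : tricomplex T0).
Local Notation C := R[i].
Local Notation eps := (levi_civita R).

Lemma insertsP (g h : seq T0) j t : inserts T g h j t ->
  exists g1 g2 x y z, [/\ g = g1 ++ x :: z :: g2, h = g1 ++ x :: y :: z :: g2,
    size g1 = j, t = [set x; y; z]%SET & t \in triangles T].
Proof.
case/and3P => jg tT /existsP[y /andP[/eqP tE /eqP hE]].
have j2 : (j.+1 < size g)%N by rewrite /plength in jg; lia.
have j1 : (j < size g)%N by lia.
exists (take j g), (drop j.+2 g), (nth y g j), y, (nth y g j.+1).
have gE : g = take j g ++ nth y g j :: nth y g j.+1 :: drop j.+2 g.
  by rewrite -2?drop_nth ?cat_take_drop.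
split=> //; last by rewrite size_takel // ltnW.
by rewrite hE (take_nth y) // -cats1 -catA /= -drop_nth.
Qed.

Lemma insertsI g1 g2 x y z : [set x; y; z]%SET \in triangles T ->
  inserts T (g1 ++ x :: z :: g2) (g1 ++ x :: y :: z :: g2) (size g1) [set x; y; z]%SET.
Proof.
move=> tT; apply/and3P; split=> //; first by rewrite /plength size_cat /=; lia.
apply/existsP; exists y.
have -> : nth y (g1 ++ [:: x, z & g2]) (size g1) = x by rewrite nth_cat ltnn subnn.
have -> : nth y (g1 ++ [:: x, z & g2]) (size g1).+1 = z.
  by rewrite nth_cat ltnNge leqnSn /= subSnn.
by rewrite eqxx /= -!(cat_rcons x) take_size_cat ?drop_size_cat ?size_rcons.
Qed.

Lemma inserts_size g h j t : inserts T g h j t -> size h = (size g).+1.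
Proof. by case/insertsP => g1 [g2 [x [y [z [-> -> _ _ _]]]]];
  rewrite !size_cat /= !addnS. Qed.

Lemma triangle_neq x y z : [set x; y; z]%SET \in triangles T ->
  [/\ x != y, y != z & x != z].
Proof.
move=> /card_triangle; rewrite -finset.setUA cardsU1 cards2 !inE.
by case: (x == y); case: (y == z); case: (x == z).
Qed.

Lemma inserts_inj g h j j' t t' :
  inserts T g h j t -> inserts T g h j' t' -> j = j' /\ t = t'.
Proof.
wlog le : j j' t t' / (j <= j')%N.
  move=> H I I'; case: (leqP j j') => [le|/ltnW le]; first exact: H le I I'.
  by have [-> ->] := H _ _ _ _ le I' I.
case/insertsP => g1 [g2 [x [y [z [gE hE sj tE tT]]]]].
case/insertsP => g1' [g2' [x' [y' [z' [gE' hE' sg tE' tT']]]]].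
have [_ yz _] := triangle_neq (eq_ind _ (fun t => t \in triangles T) tT _ tE).
move: le; rewrite leq_eqVlt -sj => /orP[/eqP ej|lt].
  have sgg : size g1' = size g1 by rewrite sg -ej.
  have := gE; rewrite gE' => /eqP;
    rewrite eqseq_cat // => /andP[/eqP e1 /eqP[e2 e3 e4]].
  have := hE; rewrite hE' e1 => /eqP; rewrite eqseq_cat // => /andP[_ /eqP[_ ey _ _]].
  by rewrite ej tE tE' e2 e3 ey.
have : nth y h (size g1).+1 = nth y g (size g1).+1.
  rewrite hE' gE' -2!(cat_rcons x') !nth_cat size_rcons sg.
  by rewrite ltnS lt.
rewrite hE gE !nth_cat ltnNge leqnSn /= subSnn /= => yz'.
by rewrite yz' eqxx in yz.
Qed.

Lemma phi_F g h j t : inserts T g h j t ->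
  phi R T h g = conform_mx 0 (tensmx (tensmx (1%:M : 'M[C]_(3 ^ j)) (F R))
                   (1%:M : 'M[C]_(3 ^ (plength g - j - 1)))).
Proof.
move=> I; rewrite /phi; case: pickP => [j' /existsP[t' I']|none].
  by have [-> _] := inserts_inj I I'.
have jg : (j < plength g)%N by case/and3P: I.
by have /existsP[] := none (Ordinal jg); exists t.
Qed.

Lemma phi_Ftilde g h j t : inserts T g h j t ->
  phi R T g h = conform_mx 0 (tensmx (tensmx (1%:M : 'M[C]_(3 ^ j)) (Ftilde R))
                   (1%:M : 'M[C]_(3 ^ (plength g - j - 1)))).
Proof.
move=> I; rewrite /phi; case: pickP => [j' /existsP[t' I']|_].
  by have := inserts_size I; rewrite (inserts_size I'); lia.
case: pickP => [j' /existsP[t' I']|none].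
  by have [-> _] := inserts_inj I I'.
have jg : (j < plength g)%N by case/and3P: I.
by have /existsP[] := none (Ordinal jg); exists t.
Qed.

Lemma code_lt_size w n : size w = n -> (code w < 3 ^ n)%N.
Proof. by move=> <-; apply: code_lt. Qed.

Lemma code_eq u v : size u = size v -> (code u == code v) = (u == v).
Proof. by move=> s; apply/eqP/eqP => [/code_inj->|->]. Qed.

(** Words u1, um, u2 and v1, vm, v2 index the rows and the columns of the three
tensor factors. *)
Lemma mx_entry_local m n (M : 'M[C]_(3 ^ m, 3 ^ n)) (a b : nat) u1 u2 v1 v2 um vm :
  size u1 = a -> size v1 = a -> size u2 = b -> size v2 = b -> size um = m ->
    size vm = n ->
  mx_entry (tensmx (tensmx (1%:M : 'M[C]_(3 ^ a)) M) (1%:M : 'M[C]_(3 ^ b)))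
     (code (u1 ++ um ++ u2)) (code (v1 ++ vm ++ v2)) =
  if (u1 == v1) && (u2 == v2) then mx_entry M (code um) (code vm) else 0.
Proof.
move=> s1 t1 s2 t2 sm tm; rewrite !catA !(code_cat (_ ++ _)) s2 t2.
have lt_cat n1 n2 w1 w2 : size w1 = n1 -> size w2 = n2 ->
  (code (w1 ++ w2) < 3 ^ n1 * 3 ^ n2)%N.
  by move=> <- <-; have := code_lt (w1 ++ w2); rewrite size_cat expnD.
rewrite mx_entry_tens ?lt_cat ?code_lt_size //.
rewrite !code_cat sm tm mx_entry_tens ?code_lt_size // !mx_entry_id ?code_lt_size //.
rewrite !code_eq ?s1 ?s2 //.
by do 2!case: eqP => _; rewrite ?(mul1r, mulr1, mul0r, mulr0).
Qed.

End Phi.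

(** * Sweeping events and their boundary *)

Lemma odd_sum_sym (I : finType) (f : I -> I -> nat) :
  (forall i j, f i j = f j i) -> (forall i, f i i = 0%N) ->
  ~~ odd (\sum_i \sum_j f i j).
Proof.
move=> fC f0.
pose lt (ij : I * I) := (enum_rank ij.1 < enum_rank ij.2)%N.
rewrite pair_big /= (bigID lt) /=
  [X in (_ + X)%N](_ : _ = \sum_(ij | lt ij) f ij.1 ij.2)%N.
  by rewrite addnn odd_double.
rewrite (bigID (fun ij => ij.1 == ij.2)) /= big1 ?add0n;
  last by case=> i j /= /andP[_ /eqP ->].
rewrite (reindex_inj (h := fun ij : I * I => (ij.2, ij.1))) /=;
  last by case=> i j [k l] [-> ->].
apply: eq_big => [[i j]|[i j] _]; last exact: fC.
rewrite /lt /= -leqNgt leq_eqVlt val_eqE (inj_eq enum_rank_inj) (eq_sym j).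
by case: eqP => [->|] /=; rewrite ?ltnn ?andbT.
Qed.

Section Events.
Variables (T0 : finType).
Local Notation carc := (T0 * T0 * 'I_3)%type.

(** One step of a colored 2-path: the arcs (x, y), (y, z) with colors b, c and the
arc (x, z) with color a replace each other between the unchanged colored arcs
ev_pre and ev_post; ev_grow tells whether the path gets longer. *)
Record event := Event {
  ev_x : T0; ev_y : T0; ev_z : T0;
  ev_b : 'I_3; ev_c : 'I_3; ev_a : 'I_3;
  ev_pre : seq carc; ev_post : seq carc;
  ev_grow : bool }.

Definition ev_tri e : {set T0} := [set ev_x e; ev_y e; ev_z e]%SET.
Definition ev_long e :=
  ev_pre e ++ (ev_x e, ev_y e, ev_b e) :: (ev_y e, ev_z e, ev_c e) :: ev_post e.
Definition ev_short e := ev_pre e ++ (ev_x e, ev_z e, ev_a e) :: ev_post e.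
Definition ev_before e := if ev_grow e then ev_short e else ev_long e.
Definition ev_after e := if ev_grow e then ev_long e else ev_short e.
Definition ev_arcs e :=
  [:: (ev_x e, ev_y e, ev_b e); (ev_y e, ev_z e, ev_c e); (ev_x e, ev_z e, ev_a e)].

(** Algebraic number of passages from a to b with color k: the coefficients of a
list of colored arcs seen as a 1-chain. *)
Definition unit_flow (a b : T0) (k : 'I_3) (d : carc) : int :=
  (d == (a, b, k))%:Z - (d == (b, a, k))%:Z.
Definition flow (a b : T0) (k : 'I_3) (L : seq carc) : int := \sum_(d <- L) unit_flow
  a b k d.

Lemma flowE a b k L : flow a b k L =
  (count_mem (a, b, k) L)%:Z - (count_mem (b, a, k) L)%:Z.
Proof.
rewrite /flow /unit_flow; elim: L => [|d L IH]; first by rewrite big_nil.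
by rewrite big_cons IH /= !PoszD; lia.
Qed.

Lemma unit_flow_rev a b k x y c : unit_flow a b k (y, x, c) =
  - unit_flow a b k (x, y, c).
Proof.
rewrite /unit_flow opprB !xpair_eqE.
by rewrite (andbC (y == a)) (andbC (y == b)).
Qed.

Variable (pos : T0 -> T0 -> T0 -> bool).

(** The boundary of the triangle, in the direction given by the orientation. *)
Definition rim e : seq carc :=
  let: Event x y z b c a _ _ _ := e in
  if pos x y z then [:: (x, y, b); (y, z, c); (z, x, a)]
  else [:: (y, x, b); (z, y, c); (x, z, a)].

Definition coherent e := ev_grow e == pos (ev_x e) (ev_y e) (ev_z e).

(** Replacing (x, z) by (x, y), (y, z) adds the boundary x, y, z, x to the path
seen as a 1-chain, and the inverse replacement subtracts it; the sign compares
this boundary with the oriented one. *)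
Lemma flow_step a b k e : flow a b k (ev_after e) - flow a b k (ev_before e) =
  (-1) ^+ (~~ coherent e) * flow a b k (rim e).
Proof.
have ls : flow a b k (ev_long e) - flow a b k (ev_short e) =
    (-1) ^+ (~~ pos (ev_x e) (ev_y e) (ev_z e)) * flow a b k (rim e).
  case: e => x y z cb cc ca X Y g;
    rewrite /ev_long /ev_short /flow !big_cat !big_cons /=.
  have -> : unit_flow a b k (x, z, ca) = - unit_flow a b k (z, x, ca).
    by rewrite unit_flow_rev.
  case: ifP => _; rewrite !big_cons big_nil /=; first by lia.
  rewrite (unit_flow_rev _ _ _ x y) (unit_flow_rev _ _ _ y z)
    (unit_flow_rev _ _ _ z x); lia.
rewrite /ev_after /ev_before /coherent; case: ev_grow; first by rewrite ls;
  case: (pos _ _ _).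
rewrite -opprB ls; case: (pos _ _ _) => /=; lia.
Qed.

Variable T : tricomplex T0.
Hypothesis orT : is_orientation T pos.

Lemma pos_neq x y z : pos x y z -> [/\ x != y, y != z & x != z].
Proof. by case: orT => tri _ _ _ /tri /triangle_neq. Qed.

Lemma pos_cyc x y z : pos x y z -> pos y z x.
Proof. by case: orT => _ c _ _ /c. Qed.

(** An oriented arc bounds at most one triangle on its positive side, since two
triangles on an edge induce opposite directions on it. *)
Lemma pos_third a b w w' : pos a b w -> pos a b w' -> w = w'.
Proof.
case: orT => tri _ anti opp p p'; apply/eqP; apply: contraT => ww'.
have := opp _ _ _ _ p (tri _ _ _ p'); rewrite eq_sym => /(_ ww').
by have := p'; rewrite (anti _ _ _ (tri _ _ _ p')) => /negP.
Qed.

Lemma rim_pos e : ev_tri e \in triangles T ->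
  exists x y z b c a, [/\ rim e =i [:: (x, y, b); (y, z, c); (z, x, a)], uniq (rim e),
    pos x y z & ev_tri e = [set x; y; z]%SET].
Proof.
case: e => x y z b c a X Y g; rewrite /ev_tri /= => tT.
have U x' y' z' b' c' a' : pos x' y' z' ->
  uniq [:: (x', y', b'); (y', z', c'); (z', x', a') : carc].
  case/pos_neq => xy yz xz; rewrite /= !inE !xpair_eqE.
  by rewrite (negbTE xy) (negbTE yz) (negbTE xz) ?andbF.
case: ifP => pxyz; first by exists x, y, z, b, c, a; split=> //; apply: U.
have pyxz : pos y x z.
  by case: orT => _ _ anti _; move: pxyz; rewrite anti // => /negbFE.
exists y, x, z, b, a, c; split=> //.
- by move=> d; rewrite !inE (orbC (d == (z, y, c))).
- have [yx xz yz] := pos_neq pyxz; rewrite /= !inE !xpair_eqE.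
  by rewrite (negbTE yz) (negbTE yx) (eq_sym z) (negbTE xz) ?andbF.
by rewrite (finset.setUC [set x]%SET).
Qed.

Lemma rim_arc e a b k : ev_tri e \in triangles T -> (a, b, k) \in rim e ->
  exists2 w, pos a b w & ev_tri e = [set a; b; w]%SET.
Proof.
move=> /rim_pos[x [y [z [cb [cc [ca [-> _ p tE]]]]]]].
have rotE (u v w : T0) : [set u; v; w]%SET = [set v; w; u]%SET.
  by rewrite -finset.setUA finset.setUC.
rewrite !inE => /or3P[] /eqP[-> -> _].
- by exists z.
- by exists x; [apply: pos_cyc|rewrite tE; apply: rotE].
by exists y; [apply/pos_cyc/pos_cyc|rewrite tE; apply/esym/rotE].
Qed.

Lemma rim_arc_tri e e' a b k k' : ev_tri e \in triangles T ->
  ev_tri e' \in triangles T ->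
  (a, b, k) \in rim e -> (a, b, k') \in rim e' -> ev_tri e = ev_tri e'.
Proof.
move=> eT e'T /(rim_arc eT)[w p ->] /(rim_arc e'T)[w' p' ->].
by rewrite (pos_third p p').
Qed.

Lemma rim_arc_color e a b k k' : ev_tri e \in triangles T ->
  (a, b, k) \in rim e -> (a, b, k') \in rim e -> k = k'.
Proof.
move=> /rim_pos[x [y [z [cb [cc [ca [rE _ /pos_neq[xy yz xz] _]]]]]]].
rewrite !rE !inE !xpair_eqE => /or3P[] /andP[/andP[/eqP -> /eqP ->] /eqP ->];
  rewrite !eqxx ?(eq_sym z) ?(eq_sym y x) ?(negbTE xy) ?(negbTE yz) ?(negbTE xz) /=
    ?andbF /=;
  by rewrite ?orbF => /eqP.
Qed.

Lemma rim_edge e a b : ev_tri e \in triangles T -> a != b ->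
  [set a; b]%SET \subset ev_tri e ->
  exists k, (a, b, k) \in rim e \/ (b, a, k) \in rim e.
Proof.
move=> /rim_pos[x [y [z [cb [cc [ca [rE _ _ ->]]]]]]] ab /fintype.subsetP sub.
have := sub b; have := sub a; rewrite !inE !eqxx orbT => /(_ isT) + /(_ isT).
case/orP => [/orP[]|] /eqP ea; case/orP => [/orP[]|] /eqP eb; move: ab;
  rewrite ea eb ?eqxx // => _;
by [exists cb; rewrite !rE !inE !eqxx ?orbT; auto|exists cc;
  rewrite !rE !inE !eqxx ?orbT; auto
   |exists ca; rewrite !rE !inE !eqxx ?orbT; auto].
Qed.

Lemma ev_arcs_rim e a b k : (a, b, k) \in ev_arcs e ->
  (a, b, k) \in rim e \/ (b, a, k) \in rim e.
Proof.
case: e => x y z cb cc ca X Y g; rewrite /ev_arcs /= !inE.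
by case/or3P => /eqP[-> -> ->]; case: ifP => _; rewrite !inE !eqxx ?orbT; auto.
Qed.

Lemma rim_ev_arcs e a b k : (a, b, k) \in rim e ->
  (a, b, k) \in ev_arcs e \/ (b, a, k) \in ev_arcs e.
Proof.
case: e => x y z cb cc ca X Y g; rewrite /ev_arcs /=.
by case: ifP => _; rewrite !inE => /or3P[] /eqP[-> -> ->]; rewrite !eqxx ?orbT; auto.
Qed.

Lemma ev_arcs_sides e d : d \in ev_arcs e ->
  (d \in ev_before e) || (d \in ev_after e).
Proof.
rewrite /ev_arcs /ev_before /ev_after /ev_long /ev_short !inE => /or3P[] /eqP ->;
by case: ifP => _; rewrite !mem_cat !inE !eqxx ?orbT.
Qed.
End Events.

(** * Closed sequences of events on a sphere *)

Section Loop.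
Variables (R : realType) (T0 : finType) (T : tricomplex T0).
Variables (pos : T0 -> T0 -> T0 -> bool) (orT : is_orientation T pos).
Hypothesis sphereT : triangulates_sphere R T.
Local Notation carc := (T0 * T0 * 'I_3)%type.
Variables (n : nat) (P : nat -> seq carc) (ev : 'I_n -> event T0).
Hypothesis Pbefore : forall p : 'I_n, P p = ev_before (ev p).
Hypothesis Pafter : forall p : 'I_n, P p.+1 = ev_after (ev p).
Hypothesis Pn : P n = P 0.
Hypothesis triT : forall p, ev_tri (ev p) \in triangles T.
Hypothesis tri_inj : injective (fun p => ev_tri (ev p)).
Hypothesis tri_surj : forall t, t \in triangles T -> exists p, t = ev_tri (ev p).
Hypothesis edgeP : forall p a b k, (p <= n)%N -> (a, b, k) \in P p ->
  [set a; b]%SET \in edges T.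
Hypothesis nohead : forall d : T0 * T0, ~ forall p, (p <= n)%N ->
  exists k Q, P p = (d, k) :: Q.
Hypothesis nolast : forall d : T0 * T0, ~ forall p, (p <= n)%N ->
  exists k Q, P p = rcons Q (d, k).

Local Notation rim_at p := (rim pos (ev p)).
Local Notation coherent_at p := (coherent pos (ev p)).

(** The triangles swept at the steps in A, with their signs and colors, form a
cycle. *)
Definition closed_part (A : pred 'I_n) := forall a b k,
  \sum_(p | A p) (-1) ^+ (~~ coherent_at p) * flow a b k (rim_at p) = 0.

Lemma closed_total : closed_part xpredT.
Proof.
move=> a b k; under eq_bigr => p _ do rewrite -flow_step -Pbefore -Pafter.
rewrite -(big_mkord xpredT (fun p => flow a b k (P p.+1) - flow a b k (P p))).
by rewrite telescope_sumr // Pn subrr.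
Qed.

Lemma rim_count p q a b k : (a, b, k) \in rim_at p ->
  count_mem (a, b, k) (rim_at q) = (q == p).
Proof.
move=> dp; case: eqP => [->|qp].
  have [x [y [z [cb [cc [ca [_ U _ _]]]]]]] := rim_pos orT (triT p).
  by rewrite count_uniq_mem // dp.
apply/count_memPn/negP => dq; apply: qp; apply: tri_inj => /=.
exact: (rim_arc_tri orT (triT q) (triT p) dq dp).
Qed.

Lemma rim_count_sum (A : pred 'I_n) p a b k (f : 'I_n -> int) : A p ->
  (a, b, k) \in rim_at p ->
  \sum_(q | A q) f q * (count_mem (a, b, k) (rim_at q))%:Z = f p.
Proof.
move=> Ap dp; rewrite (bigD1 p) //= big1 ?addr0 => [|q /andP[_ qp]].
  by rewrite (rim_count _ dp) eqxx mulr1.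
by rewrite (rim_count _ dp) (negbTE qp) mulr0.
Qed.

(** The arc (a, b) is in the rim of no other event, so its coefficient in the
boundary can only be canceled by the one event with (b, a) in its rim, which
must then have the same color and the same sign. *)
Lemma closed_neighbor A p a b k : closed_part A -> A p -> (a, b, k) \in rim_at p ->
  exists q, [/\ A q, (b, a, k) \in rim_at q & coherent_at q = coherent_at p].
Proof.
move=> clA Ap dp; have := clA a b k.
under eq_bigr do rewrite flowE mulrBr.
rewrite sumrB (rim_count_sum _ Ap dp) => /eqP; rewrite subr_eq0 => /eqP E.
have [q /andP[Aq dq]|none] := pickP [pred q | A q && ((b, a, k) \in rim_at q)].
  exists q; split=> //; move: E; rewrite (rim_count_sum _ Aq dq).
  by case: (coherent_at q); case: (coherent_at p).
move: E; rewrite [RHS]big1; first by case: (coherent_at p).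
move=> q Aq; rewrite (count_memPn _) ?mulr0 //.
by have /= := none q; rewrite Aq /= => ->.
Qed.

Lemma rim_color p q a b k k' : (a, b, k) \in rim_at p -> (a, b, k') \in rim_at q ->
  k = k'.
Proof.
move=> dp dq; have E := tri_inj (rim_arc_tri orT (triT p) (triT q) dp dq).
by apply: (rim_arc_color orT (triT p) dp); rewrite E.
Qed.

Lemma rim_color_rev p q a b k k' : (a, b, k) \in rim_at p ->
  (b, a, k') \in rim_at q -> k = k'.
Proof.
move=> dp dq; have [q' [_ dq' _]] := closed_neighbor closed_total isT dp.
exact: rim_color dq' dq.
Qed.

Lemma mem_loop d p : (forall q, d \notin ev_arcs (ev q)) -> (p <= n)%N ->
  (d \in P p) = (d \in P 0).
Proof.
move=> dm; elim: p => // p IH pn; rewrite -IH; last exact: ltnW.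
rewrite (Pbefore (Ordinal pn)) (Pafter (Ordinal pn)).
have := dm (Ordinal pn); set e := ev _.
rewrite /ev_arcs /ev_before /ev_after /ev_short /ev_long !inE => /norP[n1 /norP[n2 n3]].
by case: ifP => _; rewrite !mem_cat !inE ?(negbTE n1) ?(negbTE n2) ?(negbTE n3).
Qed.

(** An arc that is never swept is followed through the loop by its first
occurrence in the paths. *)
Section Eternal.
Variable d : carc.
Hypothesis d_unswept : forall p, d \notin ev_arcs (ev p).
Hypothesis d0 : d \in P 0.

Let k p := index d (P p).
Let left_part p := take (k p) (P p).
Let right_part p := drop (k p).+1 (P p).

Lemma eternal_split p : (p <= n)%N -> P p = left_part p ++ d :: right_part p.
Proof.
move=> pn; have dp : d \in P p by rewrite (mem_loop d_unswept pn).
rewrite -[in d :: _](nth_index d dp) -drop_nth ?cat_take_drop //.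
by rewrite index_mem.
Qed.

Let on_left : pred 'I_n := [pred p | d \notin ev_pre (ev p)].

Lemma eternal_on_right p : ~~ on_left p -> left_part p.+1 = left_part p.
Proof.
rewrite negbK => dX; rewrite /left_part /k Pbefore Pafter.
move: dX; case: (ev p) => x y z cb cc ca X Y g /= dX.
by rewrite /ev_before /ev_after /ev_long /ev_short; case: ifP => _ /=;
  rewrite !index_cat dX !take_cat index_mem dX.
Qed.

(** Cutting ev_post just before d gives an event with the same rim which
relates the left parts. *)
Lemma eternal_on_left p : on_left p -> right_part p.+1 = right_part p /\
  forall a b l, flow a b l (left_part p.+1) - flow a b l (left_part p) =
    (-1) ^+ (~~ coherent_at p) * flow a b l (rim_at p).
Proof.
move=> Lp; have dX : d \notin ev_pre (ev p) by exact: Lp.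
have := mem_loop d_unswept (ltnW (ltn_ord p)); rewrite d0; have := d_unswept p.
rewrite /left_part /right_part /k Pbefore Pafter.
case: (ev p) dX => x y z cb cc ca X Y g /= dX.
rewrite /ev_arcs /= !inE => /norP[n1 /norP[n2 n3]].
move=> dP; have dY : d \in Y.
  move: dP; rewrite /ev_before /ev_long /ev_short /=; case: ifP => _;
  by rewrite mem_cat !inE (negbTE dX) ?(negbTE n1) ?(negbTE n2) ?(negbTE n3).
pose e' := Event x y z cb cc ca X (take (index d Y) Y) g.
have short_split : ev_short (Event x y z cb cc ca X Y g) =
    ev_short e' ++ drop (index d Y) Y.
  by rewrite /ev_short /= -catA /= cat_take_drop.
have long_split : ev_long (Event x y z cb cc ca X Y g) =
    ev_long e' ++ drop (index d Y) Y.
  by rewrite /ev_long /= -catA /= cat_take_drop.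
have dtake : d \notin take (index d Y) Y.
  by rewrite in_take ?index_size // ltnn.
have drop_index : drop (index d Y) Y = d :: drop (index d Y).+1 Y.
  by rewrite (drop_nth d) ?index_mem // nth_index.
have nshort : d \notin ev_short e'.
  by rewrite /ev_short /= mem_cat inE (negbTE dX) (negbTE n3) (negbTE dtake).
have nlong : d \notin ev_long e'.
  by rewrite /ev_long /= mem_cat !inE (negbTE dX) (negbTE n1) (negbTE n2)
    (negbTE dtake).
have cut L : d \notin L ->
  take (index d (L ++ drop (index d Y) Y)) (L ++ drop (index d Y) Y) = L
    /\ drop (index d (L ++ drop (index d Y) Y)).+1 (L ++ drop (index d Y) Y) =
      drop (index d Y).+1 Y.
  move=> dL; rewrite index_cat (negbTE dL) drop_index /= eqxx addn0 take_size_cat //.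
  by rewrite -cat_rcons drop_size_cat // size_rcons.
have [cs1 cs2] := cut _ nshort; have [cl1 cl2] := cut _ nlong.
split.
  by rewrite /ev_before /ev_after short_split long_split; case: ifP; rewrite cs2 cl2.
move=> a b l; have := flow_step pos a b l e'.
rewrite (_ : coherent pos e' = coherent pos (Event x y z cb cc ca X Y g)) //.
by rewrite /ev_before /ev_after /= short_split long_split; case: ifP => _;
  rewrite cs1 cl1 => ->.
Qed.

Lemma closed_left : closed_part on_left.
Proof.
move=> a b l; transitivity
  (\sum_(p < n) (flow a b l (left_part p.+1) - flow a b l (left_part p))).
  rewrite [RHS](bigID on_left) /= [X in _ + X]big1 ?addr0 => [|p Np].
    by apply: eq_bigr => p Ap; rewrite (eternal_on_left Ap).2.
  by rewrite (eternal_on_right Np) subrr.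
rewrite -(big_mkord xpredT
  (fun p => flow a b l (left_part p.+1) - flow a b l (left_part p))).
by rewrite telescope_sumr // /left_part /k Pn subrr.
Qed.

(** If events happen on both sides of d, two triangles on opposite sides share an
edge. By [closed_neighbor] both triangles on this edge are swept on the left. If
all events happen on one side, the other part of the paths is constant, and so
is the first or the last edge of the paths. *)
Lemma no_eternal : False.
Proof.
have [p1 Ap1|noleft] := pickP on_left; last first.
  have Lp p : (p <= n)%N -> left_part p = left_part 0.
    elim: p => // p IH pn; rewrite -IH ?(ltnW pn) //.
    by apply: (@eternal_on_right (Ordinal pn)); have := noleft (Ordinal pn) => /= ->.
  (* If the left part is empty, the common first arc is d itself. *)
  apply: (nohead (d := (head d (left_part 0)).1)) => p pn.
  rewrite (eternal_split pn) Lp //; case: (left_part 0) => [|[d' c] L] /=.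
    by exists d.2, (right_part p); case: (d).
  by exists c, (L ++ d :: right_part p).
have [p2 Ap2|noright] := pickP (predC on_left); last first.
  have Rp p : (p <= n)%N -> right_part p = right_part 0.
    elim: p => // p IH pn; rewrite -IH ?(ltnW pn) //.
    apply: (proj1 (@eternal_on_left (Ordinal pn) _)).
    by have := noright (Ordinal pn) => /= /negbFE ->.
  apply: (nolast (d := (last d (right_part 0)).1)) => p pn.
  rewrite (eternal_split pn) Rp //; case/lastP: (right_part 0) => [|L [d' c]] /=.
    by exists d.2, (left_part p); rewrite cats1; case: (d).
  by exists c, (left_part p ++ d :: L); rewrite last_rcons rcons_cat rcons_cons.
pose A : {set {set T0}} := [set ev_tri (ev p) | p in on_left]%SET.
have t1A : ev_tri (ev p1) \in A by apply: imset_f.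
have t2A : ev_tri (ev p2) \notin A.
  by apply/imsetP => -[p Ap /tri_inj E]; move: Ap2; rewrite /= E => /negP.
have [t [t' [a [b [[tT t'T tA t'A] ab abt abt']]]]] :=
  triangles_edge_connected sphereT (triT p1) (triT p2) t1A t2A.
case/imsetP: tA => p Ap tE; have [q t'E] := tri_surj t'T.
rewrite {}tE in abt; rewrite {}t'E in t'A abt'; have {t'A} nAq : ~~ on_left q.
  by apply: contra t'A => Aq; apply: imset_f.
(* An event q on the right with u, v on its rim is p or the neighbor of p. *)
have same u v l : (u, v, l) \in rim_at p -> forall l',
    (u, v, l') \in rim_at q \/ (v, u, l') \in rim_at q -> False.
  move=> dp l' [dq|dq].
    have E := tri_inj (rim_arc_tri orT (triT p) (triT q) dp dq).
    by case/negP: nAq; rewrite -E.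
  have [q' [Aq' dq' _]] := closed_neighbor closed_left Ap dp.
  have E := tri_inj (rim_arc_tri orT (triT q') (triT q) dq' dq).
  by case/negP: nAq; rewrite -E.
have [l' dq] := rim_edge orT (triT q) ab abt'.
have [l [dp|dp]] := rim_edge orT (triT p) ab abt; first exact: same dp _ dq.
by apply: (same _ _ _ dp l'); case: dq; auto.
Qed.

End Eternal.

Lemma loop_arc p a b k : (p <= n)%N -> (a, b, k) \in P p ->
  exists q, (a, b, k) \in rim_at q \/ (b, a, k) \in rim_at q.
Proof.
move=> pn dp; have eE := edgeP pn dp.
have ab : a != b by have := card_edge eE; rewrite cards2; case: eqP.
have [t tT et] := edge_in_triangle sphereT eE.
have [q tE] := tri_surj tT; rewrite {}tE in et.
have [l dq] := rim_edge orT (triT q) ab et.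
have [<-|kl] := eqVneq l k; first by exists q.
have unswept p' : (a, b, k) \notin ev_arcs (ev p').
  apply/negP => /(ev_arcs_rim pos) dp'; move/eqP: kl; apply.
  case: dp'; case: dq => dq dp'; by
    [apply: rim_color dq dp'|apply: rim_color_rev dq dp'].
by case: (no_eternal unswept); rewrite -(mem_loop unswept pn).
Qed.

(** All occurrences of an edge in the paths have the color that the edge has in
the rims: an occurrence with another color would never be swept. *)
Lemma loop_color p p' a b a' b' k k' : (p <= n)%N -> (p' <= n)%N ->
  (a, b, k) \in P p -> (a', b', k') \in P p' -> [set a; b]%SET = [set a'; b']%SET ->
    k = k'.
Proof.
move=> pn pn' dp dp' E.
have ab : a != b by have := card_edge (edgeP pn dp); rewrite cards2; case: eqP.
have [q dq] := loop_arc pn dp; have [q' dq'] := loop_arc pn' dp'.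
have : (a' = a /\ b' = b) \/ (a' = b /\ b' = a).
  have := set21 a b; have := set22 a b;
    rewrite E !inE => /orP[] /eqP eb /orP[] /eqP ea; move: ab.
  - by rewrite ea eb eqxx.
  - by rewrite ea eb; auto.
  - by rewrite ea eb; auto.
  - by rewrite ea eb eqxx.
case=> -[ea eb]; rewrite {}ea {}eb in dq'; case: dq dq' => dq [] dq';
  by [apply: rim_color dq dq'|apply: rim_color_rev dq dq'].
Qed.

(** Let f a b count the negatively swept triangles with (a, b) in their rim. It is
symmetric by [closed_neighbor] and vanishes on the diagonal, so that its sum,
three times the number of negatively swept triangles, is even. *)
Lemma prod_sign (A : comPzRingType) : \prod_(p < n) (-1) ^+ (~~ coherent_at p) = 1 :> A.
Proof.
pose m p (ab : T0 * T0) : nat := count_mem ab [seq d.1 | d <- rim_at p].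
pose f a b : nat := (\sum_(p < n) ~~ coherent_at p * m p (a, b))%N.
have mP p a b : reflect (exists k, (a, b, k) \in rim_at p)
  ((a, b) \in [seq d.1 | d <- rim_at p]).
  apply: (iffP mapP) => [[[d k] dp /= ->]|[k dp]]; first by case: d dp => ? ? dp;
    exists k.
  by exists (a, b, k).
have uniq1 p : uniq [seq d.1 | d <- rim_at p].
  have [x [y [z [cb [cc [ca [_ U _ _]]]]]]] := rim_pos orT (triT p).
  rewrite map_inj_in_uniq // => -[[a b] k] [[a' b'] k'] dp dp' /= [ea eb].
  by move: dp' => /=; rewrite -ea -eb => dp'; rewrite (rim_color dp dp').
have fP p a b k : (a, b, k) \in rim_at p -> f a b = ~~ coherent_at p.
  move=> dp; rewrite /f (bigD1 p) //= big1 ?addn0 => [|q qp].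
    by rewrite /m count_uniq_mem // (introT (mP _ _ _)) ?muln1 //; exists k.
  rewrite /m (count_memPn _) ?muln0 //; apply/mP => -[k' dq].
  by move/eqP: qp; apply; apply: tri_inj;
    exact: (rim_arc_tri orT (triT q) (triT p) dq dp).
have fC a b : f a b = f b a.
  wlog [p [k dp]] : a b / exists p k, (a, b, k) \in rim_at p.
    move=> W; have [|nab] := pselect (exists p k, (a, b, k) \in rim_at p);
      first exact: W.
    have [|nba] := pselect (exists p k, (b, a, k) \in rim_at p); first by move=> H;
      symmetry; apply: W.
    have none u v : ~ (exists p k, (u, v, k) \in rim_at p) -> f u v = 0%N.
      move=> nuv; rewrite /f big1 // => p _; rewrite /m (count_memPn _) ?muln0 //.
      by apply/mP => -[k dp]; apply: nuv; exists p, k.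
    by rewrite !none.
  have [q [_ dq cq]] := closed_neighbor closed_total isT dp.
  by rewrite (fP _ _ _ _ dp) (fP _ _ _ _ dq) cq.
have f0 a : f a a = 0%N.
  rewrite /f big1 // => p _; rewrite /m (count_memPn _) ?muln0 //; apply/mP => -[k dp].
  by have [w /(pos_neq orT)[]] := rim_arc orT (triT p) dp; rewrite eqxx.
have := odd_sum_sym fC f0.
rewrite pair_big /= exchange_big /=.
have sz p : (\sum_(ab : T0 * T0) ~~ coherent_at p * m p (ab.1, ab.2) =
  ~~ coherent_at p * 3)%N.
  rewrite -big_distrr /=; congr (_ * _)%N.
  have -> : 3%N = size [seq d.1 | d <- rim_at p].
    by rewrite size_map; case: (ev p) => ? ? ? ? ? ? ? ? ?; rewrite /rim; case: ifP.
  rewrite -sum1_size.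
  under eq_bigr => ab _ do rewrite /m -surjective_pairing -sum1_count.
  rewrite (exchange_big_dep xpredT) //=; apply: eq_bigr => ab _.
  by rewrite (eq_bigl (fun i => i == ab)) ?big_pred1_eq // => i; rewrite eq_sym.
under eq_bigr do rewrite sz.
rewrite -big_distrl /= oddM andbT => ev_even.
rewrite -expr_sum -signr_odd (negbTE ev_even) //.
Qed.

End Loop.

(** * From 2-edges to events *)

Section Arcs.
Variable T0 : finType.
Definition arcs (g : seq T0) : seq (T0 * T0) := zip g (behead g).

Lemma size_arcs g : size (arcs g) = plength g.
Proof. by rewrite size_zip size_behead; apply/minn_idPr/leq_pred. Qed.

Lemma arcs_cat g1 x g2 : arcs (g1 ++ x :: g2) = arcs (rcons g1 x) ++ arcs (x :: g2).
Proof. by elim: g1 => [|y [|y' g1] IH] //=;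
  rewrite /arcs /= -/(arcs _) -?/(arcs _) IH. Qed.

Lemma arcs_rcons2 g x y : arcs (rcons (rcons g x) y) = rcons (arcs (rcons g x)) (x, y).
Proof. by rewrite -cats1 cat_rcons arcs_cat -[RHS]cats1. Qed.

Lemma path_arcs (r : rel T0) x p a b : path r x p -> (a, b) \in arcs (x :: p) -> r a b.
Proof.
elim: p x => [|y p IH] x //= /andP[rxy ryp].
by rewrite /arcs /= inE => /orP[/eqP[-> ->] //|]; apply: IH.
Qed.

Lemma arcs_suffix g Q x y : arcs g = rcons Q (x, y) -> suffix [:: x; y] g.
Proof.
case/lastP: g => [|g b]; first by case: Q.
case/lastP: g => [|g a]; first by case: Q => [|? []].
rewrite arcs_rcons2 => /rcons_inj[_ -> ->].
by rewrite -!cats1 -catA suffix_suffix.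
Qed.
End Arcs.

Section Step.
Variables (R : realType) (T0 : finType) (T : tricomplex T0).
Local Notation C := R[i].
Local Notation eps := (levi_civita R).

Definition carcs (g : seq T0) (w : seq 'I_3) := zip (arcs g) w.

Definition ev_weight (e : event T0) : C :=
  (if ev_grow e then 'i else - 'i) * eps (ev_b e) (ev_c e) (ev_a e).

Section Local.
Variables (g1 g2 : seq T0) (x y z : T0) (u1 v1 u2 v2 : seq 'I_3) (a b c : 'I_3).
Let g := g1 ++ x :: z :: g2.
Let h := g1 ++ x :: y :: z :: g2.
Hypothesis tT : [set x; y; z]%SET \in triangles T.
Hypotheses (su1 : size u1 = size g1) (sv1 : size v1 = size g1).
Hypotheses (su2 : size u2 = size g2) (sv2 : size v2 = size g2).

Let pg : plength g = (size g1 + size g2).+1.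
Proof. by rewrite /plength /g size_cat /=; lia. Qed.
Let ph : plength h = (size g1 + size g2).+2.
Proof. by rewrite /plength /h size_cat /=; lia. Qed.
Let dg : (3 ^ size g1 * 3 * 3 ^ (plength g - size g1 - 1) = tdim g)%N.
Proof. by rewrite /tdim -expnSr -expnD pg; congr (3 ^ _)%N; lia. Qed.
Let dh : (3 ^ size g1 * (3 * 3) * 3 ^ (plength g - size g1 - 1) = tdim h)%N.
Proof.
rewrite /tdim (_ : (3 * 3 = 3 ^ 2)%N) // -!expnD ph pg; congr (3 ^ _)%N; lia.
Qed.
Let sg2 : (plength g - size g1 - 1 = size g2)%N.
Proof. by rewrite pg; lia. Qed.

Lemma phi_Ftilde_entry :
  mx_entry (phi R T g h) (code (u1 ++ a :: u2)) (code (v1 ++ b :: c :: v2)) =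
  if (u1 == v1) && (u2 == v2) then 'i * eps b c a else 0.
Proof.
rewrite (phi_Ftilde R (insertsI g1 g2 tT)) mx_entry_conform //.
have := @mx_entry_local R 1 2 (Ftilde R) (size g1) (size g2) u1 u2 v1 v2 [:: a]
  [:: b; c].
move=> /(_ su1 sv1 su2 sv2 erefl erefl); rewrite sg2 => ->.
by rewrite -Ftilde_entry -mx_entry_ord.
Qed.

Lemma phi_F_entry :
  mx_entry (phi R T h g) (code (v1 ++ b :: c :: v2)) (code (u1 ++ a :: u2)) =
  if (u1 == v1) && (u2 == v2) then - 'i * eps b c a else 0.
Proof.
rewrite (phi_F R (insertsI g1 g2 tT)) mx_entry_conform //.
have := @mx_entry_local R 2 1 (F R) (size g1) (size g2) v1 v2 u1 u2 [:: b; c] [:: a].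
move=> /(_ sv1 su1 sv2 su2 erefl erefl); rewrite sg2 => ->.
by rewrite -F_entry -mx_entry_ord (eq_sym v1) (eq_sym v2).
Qed.
End Local.

Lemma split_word (w : seq 'I_3) m k : size w = (m + k.+1)%N ->
  exists u1 a u2, [/\ w = u1 ++ a :: u2, size u1 = m & size u2 = k].
Proof.
move=> sw; exists (take m w), (nth ord0 w m), (drop m.+1 w); split.
- by rewrite -drop_nth ?cat_take_drop // sw; lia.
- by rewrite size_takel // sw; lia.
by rewrite size_drop sw; lia.
Qed.

Lemma cat_inj_size (A : eqType) (s1 s2 t1 t2 : seq A) : size s1 = size t1 ->
  s1 ++ s2 = t1 ++ t2 -> s1 = t1 /\ s2 = t2.
Proof. by move=> sz /eqP; rewrite eqseq_cat // => /andP[/eqP -> /eqP ->]. Qed.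

Lemma arcs_short (g1 g2 : seq T0) x z :
  arcs (g1 ++ x :: z :: g2) = arcs (rcons g1 x) ++ (x, z) :: arcs (z :: g2).
Proof. by rewrite arcs_cat. Qed.

Lemma arcs_long (g1 g2 : seq T0) x y z :
  arcs (g1 ++ x :: y :: z :: g2) =
    arcs (rcons g1 x) ++ (x, y) :: (y, z) :: arcs (z :: g2).
Proof. by rewrite arcs_cat. Qed.

Lemma size_arcs_rcons (g : seq T0) x : size (arcs (rcons g x)) = size g.
Proof. by rewrite size_arcs /plength size_rcons. Qed.

Lemma sweeps_uniq g h t t' : sweeps T g h t -> sweeps T g h t' -> t = t'.
Proof.
case/orP => /existsP[j I] /orP[] /existsP[j' I'].
- exact: (inserts_inj I I').2.
- by have := inserts_size I; rewrite (inserts_size I'); lia.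
- by have := inserts_size I; rewrite (inserts_size I'); lia.
exact: (inserts_inj I I').2.
Qed.

(** The second alternative covers the words induced by an edge coloring, whose
product of weights may vanish. *)
Definition compatible g h w w' :=
  mx_entry (phi R T g h) (code w) (code w') != 0 \/
  exists kap : T0 * T0 -> 'I_3, w = map kap (arcs g) /\ w' = map kap (arcs h).

Lemma split_short_long (g1 g2 : seq T0) x y z (w w' : seq 'I_3) :
  size w = plength (g1 ++ x :: z :: g2) ->
  size w' = plength (g1 ++ x :: y :: z :: g2) ->
  exists u1 a u2 v1 b c v2, [/\ w = u1 ++ a :: u2, w' = v1 ++ b :: c :: v2,
    size u1 = size g1 /\ size v1 = size g1 & size u2 = size g2 /\ size v2 = size g2].
Proof.
rewrite /plength !size_cat /= => sw sw'.
have [|u1 [a [u2 [wE su1 su2]]]] := @split_word w (size g1) (size g2).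
  by rewrite sw; lia.
have [|v1 [b [v2 [wE' sv1]]]] := @split_word w' (size g1) (size g2).+1.
  by rewrite sw'; lia.
by case: v2 wE' => // c v2 wE' [sv2]; exists u1, a, u2, v1, b, c, v2.
Qed.

Lemma map_short_long (g1 g2 : seq T0) x y z (u1 u2 v1 v2 : seq 'I_3) a b c kap :
  size u1 = size g1 -> size v1 = size g1 ->
  u1 ++ a :: u2 = map kap (arcs (g1 ++ x :: z :: g2)) ->
  v1 ++ b :: c :: v2 = map kap (arcs (g1 ++ x :: y :: z :: g2)) ->
  (u1 == v1) && (u2 == v2).
Proof.
move=> su1 sv1 + w'E; rewrite arcs_short map_cat.
move=> /cat_inj_size[|-> [_ ->]]; first by rewrite size_map size_arcs_rcons.
move: w'E; rewrite arcs_long map_cat.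
move=> /cat_inj_size[|-> [_ _ ->]]; first by rewrite size_map size_arcs_rcons.
by rewrite !eqxx.
Qed.

(** A nonzero entry, or colors read off one coloring of the arcs, force the two
words to agree away from the swept triangle, so that the step is an event. *)
Lemma step_event g h w w' : two_edge T g h ->
  size w = plength g -> size w' = plength h -> compatible g h w w' ->
  exists e, [/\ carcs g w = ev_before e, carcs h w' = ev_after e,
    sweeps T g h (ev_tri e), ev_tri e \in triangles T
    & mx_entry (phi R T g h) (code w) (code w') = ev_weight e].
Proof.
case/existsP => t sgh; case/orP: (sgh) => /existsP[j I] sw sw' cmp.
- have [g1 [g2 [x [y [z [gE hE _ tE tT]]]]]] := insertsP I.
  rewrite {}tE {t I} in tT sgh; rewrite {}gE {}hE in sw sw' cmp sgh *.
  have [u1 [a [u2 [v1 [b [c [v2 [wE wE' [su1 sv1] [su2 sv2]]]]]]]]] :=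
    split_short_long sw sw'.
  rewrite {}wE {}wE' {sw sw'} in cmp *.
  have entE := phi_Ftilde_entry a b c tT su1 sv1 su2 sv2.
  have uv : (u1 == v1) && (u2 == v2).
    case: cmp => [|[kap [w1 w2]]]; last exact: map_short_long su1 sv1 w1 w2.
    by rewrite entE; case: ifP => //; rewrite eqxx.
  rewrite uv in entE; case/andP: uv => /eqP e1 /eqP e2.
  exists (Event x y z b c a (zip (arcs (rcons g1 x)) u1) (zip (arcs (z :: g2)) u2)
    true).
  split=> //; first by rewrite /carcs arcs_short zip_cat ?size_arcs_rcons.
  by rewrite /carcs -e1 -e2 arcs_long zip_cat ?size_arcs_rcons.
have [g1 [g2 [x [y [z [hE gE _ tE tT]]]]]] := insertsP I.
rewrite {}tE {t I} in tT sgh; rewrite {}gE {}hE in sw sw' cmp sgh *.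
have [u1 [a [u2 [v1 [b [c [v2 [wE' wE [su1 sv1] [su2 sv2]]]]]]]]] :=
  split_short_long sw' sw.
rewrite {}wE {}wE' {sw sw'} in cmp *.
have entE := phi_F_entry a b c tT su1 sv1 su2 sv2.
have uv : (u1 == v1) && (u2 == v2).
  case: cmp => [|[kap [w1 w2]]]; last exact: map_short_long su1 sv1 w2 w1.
  by rewrite entE; case: ifP => //; rewrite eqxx.
rewrite uv in entE; case/andP: uv => /eqP e1 /eqP e2.
exists (Event x y z b c a (zip (arcs (rcons g1 x)) u1) (zip (arcs (z :: g2)) u2) false).
split=> //; last by rewrite /carcs arcs_short zip_cat ?size_arcs_rcons.
by rewrite /carcs -e1 -e2 arcs_long zip_cat ?size_arcs_rcons.
Qed.

End Step.

(** * The trace as a sum over sequences of words *)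

Section StateSum.
Variables (R : realType) (T0 : finType) (T : tricomplex T0).
Local Notation C := R[i].

Definition chains (gs : seq (seq T0)) : seq (seq (seq 'I_3)) :=
  foldr (fun g cs => [seq w :: ws | w <- words (plength g), ws <- cs]) [:: [::]] gs.

Lemma mem_chains gs ws : (ws \in chains gs) = (map size ws == map (@plength T0) gs).
Proof.
elim: gs ws => [|g gs IH] ws /=; first by rewrite inE; case: ws.
apply/allpairsP/idP => [[[w ws'] /= [+ + ->]]|].
  by rewrite mem_words IH /= => /eqP -> /eqP ->.
case: ws => // w ws /= /eqP[sw sws]; exists (w, ws) => /=.
by rewrite mem_words IH sw sws !eqxx.
Qed.

Lemma chains_uniq gs : uniq (chains gs).
Proof.
elim: gs => //= g gs IH; apply: allpairs_uniq => //; first exact: words_uniq.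
by move=> [w ws] [w' ws'] _ _ /= [-> ->].
Qed.

Definition chain_weight (gs : seq (seq T0)) (ws : seq (seq 'I_3)) : C :=
  \prod_(p < (size gs).-1) mx_entry (phi R T (nth [::] gs p) (nth [::] gs p.+1))
     (code (nth [::] ws p)) (code (nth [::] ws p.+1)).

Lemma phi_path_entry g0 s w0 w :
  size w0 = plength g0 -> size w = plength (last g0 s) ->
  mx_entry (phi_path R T g0 s) (code w0) (code w) =
  \sum_(ws <- chains s | last w0 ws == w) chain_weight (g0 :: s) (w0 :: ws).
Proof.
elim: s g0 w0 => [|g1 s IH] g0 w0 sw0 /= sw.
  rewrite mx_entry_id ?code_lt_size // code_eq ?sw0 ?sw // big_cons big_nil /=.
  by case: eqP => //= _; rewrite /chain_weight big_ord0 addr0.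
rewrite mx_entry_mul [LHS](sum_words _
  (fun j => mx_entry _ (code w0) j * mx_entry _ j (code w))).
rewrite [RHS]big_mkcond big_allpairs_dep /=; apply: eq_big_seq => w1;
  rewrite mem_words => /eqP sw1.
rewrite IH // big_distrr /= -big_mkcond; apply: eq_bigr => ws _.
by rewrite {2}/chain_weight big_ord_recl.
Qed.

Lemma trace_holonomy g0 s (loop : last g0 s = g0) :
  \tr (holonomy R T loop) =
  \sum_(ws <- chains (g0 :: s) | last [::] ws == head [::] ws) chain_weight (g0 :: s)
    ws.
Proof.
rewrite /mxtrace; under eq_bigr do rewrite -mx_entry_ord mx_entry_cast.
rewrite [LHS](sum_words _ (fun j => mx_entry (phi_path R T g0 s) j j)).
rewrite [RHS]big_mkcond big_allpairs_dep /=; apply: eq_big_seq => w;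
  rewrite mem_words => /eqP sw.
rewrite phi_path_entry ?loop // -big_mkcond; apply: eq_bigl => ws.
by case: ws.
Qed.

End StateSum.

(** * Edge colorings and the weights of triangles *)

Section Coloring.
Local Open Scope complex_scope.
Variables (R : realType) (T0 : finType) (T : tricomplex T0).
Local Notation C := R[i].
Local Notation eps := (levi_civita R).
Local Notation coloring := {ffun {e : {set T0} | e \in edges T} -> 'I_3}.

Definition arc_color (u : coloring) (d : T0 * T0) : 'I_3 :=
  if insub [set d.1; d.2]%SET is Some e then u e else ord0.

Lemma edge_vecE u x y : [set x; y]%SET \in edges T ->
  edge_vec R u x y = bvec R (arc_color u (x, y)).
Proof. by move=> eT; rewrite /edge_vec /arc_color /= insubT. Qed.

Lemma arc_color_rev u x y : arc_color u (y, x) = arc_color u (x, y).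
Proof. by rewrite /arc_color /= finset.setUC. Qed.

Variable pos : T0 -> T0 -> T0 -> bool.
Hypothesis orT : is_orientation T pos.

Lemma pos_anti x y z : pos x y z -> ~ pos y x z.
Proof.
move=> p; case: orT => tri _ anti _; have := anti _ _ _ (tri _ _ _ p).
by rewrite p => /esym/negP.
Qed.

Lemma pos_rotation x y z x' y' z' : pos x y z -> pos x' y' z' ->
  [set x'; y'; z']%SET = [set x; y; z]%SET ->
  [\/ [/\ x' = x, y' = y & z' = z], [/\ x' = y, y' = z & z' = x] |
      [/\ x' = z, y' = x & z' = y]].
Proof.
move=> p p' E; have [xy' yz' xz'] := pos_neq orT p'.
have p1 := pos_cyc orT p; have p2 := pos_cyc orT p1.
have mem a : a \in [set x'; y'; z']%SET -> [\/ a = x, a = y | a = z].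
  by rewrite E !inE => /orP[/orP[]|] /eqP ->;
    [constructor 1|constructor 2|constructor 3].
have mx : [\/ x' = x, x' = y | x' = z] by apply: mem; rewrite !inE eqxx.
have my : [\/ y' = x, y' = y | y' = z] by apply: mem; rewrite !inE eqxx orbT.
have mz : [\/ z' = x, z' = y | z' = z] by apply: mem; rewrite !inE eqxx !orbT.
case: mx => ex; case: my => ey; rewrite ex ey ?eqxx // in p' xy' yz' xz' *.
- by constructor 1; rewrite (pos_third orT p p').
- case: mz => ez; rewrite ez ?eqxx // in p' yz' xz'.
  by case: (pos_anti p2).
- case: mz => ez; rewrite ez ?eqxx // in p' yz' xz'.
  by case: (pos_anti p).
- by constructor 2; rewrite (pos_third orT p1 p').
- by constructor 3; rewrite (pos_third orT p2 p').
case: mz => ez; rewrite ez ?eqxx // in p' yz' xz'.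
by case: (pos_anti p1).
Qed.

Lemma triangle_weightE u x y z : pos x y z ->
  triangle_weight R pos u [set x; y; z]%SET =
  'i * eps (arc_color u (x, y)) (arc_color u (y, z)) (arc_color u (z, x)).
Proof.
move=> pxyz; have tT : [set x; y; z]%SET \in triangles T by case: orT => H _ _ _;
  apply: H.
have [xy yz xz] := pos_neq orT pxyz.
have eT a b : a \in [set x; y; z]%SET -> b \in [set x; y; z]%SET -> a != b ->
  [set a; b]%SET \in edges T.
  move=> ha hb ab; apply: (edge_of_triangle tT); last by rewrite cards2 ab.
  by apply/fintype.subsetP => c; rewrite in_set2 => /orP[] /eqP ->.
have inx : x \in [set x; y; z]%SET by rewrite !inE eqxx.
have iny : y \in [set x; y; z]%SET by rewrite !inE eqxx orbT.
have inz : z \in [set x; y; z]%SET by rewrite !inE eqxx !orbT.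
rewrite /levi_civita -!edge_vecE ?eT // 1?eq_sym //.
rewrite /triangle_weight; case: pickP => [[[x' y'] z'] /= /andP[p' /eqP tE]|none];
  last first.
  by have := none (x, y, z); rewrite /= pxyz eqxx.
congr (_ * _).
pose D a b c := det3 (edge_vec R u a b) (edge_vec R u b c) (edge_vec R u c a).
have D_cyc a b c : D b c a = D a b c by apply: det3_cyc.
rewrite -/(D x' y' z') -/(D x y z).
have [[-> -> ->]|[-> -> ->]|[-> -> ->]] := pos_rotation pxyz p' (esym tE).
- by [].
- exact: D_cyc.
exact: esym (D_cyc z x y).
Qed.

(** Exchanging Ftilde and F changes the sign of the coefficient, and exchanging
the two cyclic orders of x, y, z changes the sign of the triangle weight. *)
Lemma ev_weightE u (e : event T0) : ev_tri e \in triangles T ->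
  ev_b e = arc_color u (ev_x e, ev_y e) -> ev_c e = arc_color u (ev_y e, ev_z e) ->
  ev_a e = arc_color u (ev_x e, ev_z e) ->
  ev_weight R e = (-1) ^+ (~~ coherent pos e) * triangle_weight R pos u (ev_tri e).
Proof.
case: e => x y z b c a X Y g; rewrite /ev_tri /ev_weight /coherent /= => tT -> -> ->.
case pxyz: (pos x y z).
  rewrite triangle_weightE // (arc_color_rev u z x).
  by case: g; rewrite /= ?expr1 ?mul1r // mulN1r mulNr.
have pyxz : pos y x z.
  by case: orT => _ _ anti _; move: pxyz; rewrite anti // => /negbFE.
rewrite (finset.setUC [set x]%SET) triangle_weightE //.
rewrite (arc_color_rev u x y) (arc_color_rev u y z).
have -> : levi_civita R (arc_color u (x, y)) (arc_color u (x, z)) (arc_color u (y, z)) =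
  - levi_civita R (arc_color u (x, y)) (arc_color u (y, z)) (arc_color u (x, z)).
  by rewrite /levi_civita -det3_cyc det3_swap det3_cyc.
by case: g; rewrite /= ?expr1 ?expr0 ?mul1r ?mulN1r !mulrN ?opprK ?mulNr.
Qed.

End Coloring.

(** * Nonzero terms of the trace are edge colorings *)

Section Main.
Variables (R : realType) (T0 : finType) (T : tricomplex T0).
Hypothesis sphereT : triangulates_sphere R T.
Variable pos : T0 -> T0 -> T0 -> bool.
Hypothesis orT : is_orientation T pos.
Variables (gamma0 : seq T0) (s : seq (seq T0)).
Hypothesis path2 : two_path T gamma0 s.
Hypothesis loop : last gamma0 s = gamma0.
Hypothesis once : sweeps_each_triangle_once T gamma0 s.
Hypothesis nowhisker : whiskerless gamma0 s.
Local Notation coloring := {ffun {e : {set T0} | e \in edges T} -> 'I_3}.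
Local Notation n := (size s).
Let gamma p := nth [::] (gamma0 :: s) p.

Lemma gamma_two_edge (p : 'I_n) : two_edge T (gamma p) (gamma p.+1).
Proof. by case/andP: path2 => _ /(pathP [::]) /(_ p (ltn_ord p)). Qed.

Lemma gamma_edge_path p : (p <= n)%N -> edge_path T (gamma p).
Proof. by move=> pn; case/andP: path2 => /all_nthP + _; apply. Qed.

Lemma gamma_loop : gamma n = gamma 0.
Proof. by rewrite /gamma (nth_last [::] (gamma0 :: s)) /= loop. Qed.

Lemma arc_edge g a b : edge_path T g -> (a, b) \in arcs g -> [set a; b]%SET \in edges T.
Proof. by case: g => // x p; apply: path_arcs. Qed.

Section Chain.
Variable ws : seq (seq 'I_3).
Hypothesis ws_size : forall p, (p <= n)%N -> size (nth [::] ws p) = plength (gamma p).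
Hypothesis ws_loop : nth [::] ws n = nth [::] ws 0.
Hypothesis ws_comp : forall p : 'I_n,
  compatible R T (gamma p) (gamma p.+1) (nth [::] ws p) (nth [::] ws p.+1).
Let P p := carcs (gamma p) (nth [::] ws p).

Lemma chain_events : exists ev : 'I_n -> event T0, forall p : 'I_n,
  [/\ P p = ev_before (ev p), P p.+1 = ev_after (ev p),
    sweeps T (gamma p) (gamma p.+1) (ev_tri (ev p)),
    ev_tri (ev p) \in triangles T &
    mx_entry (phi R T (gamma p) (gamma p.+1)) (code (nth [::] ws p))
      (code (nth [::] ws p.+1)) =
      ev_weight R (ev p)].
Proof.
have step (p : 'I_n) := step_event (gamma_two_edge p) (ws_size (ltnW (ltn_ord p)))
  (ws_size (ltn_ord p)) (ws_comp p).
by have [ev evP] := boolp.choice step; exists ev.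
Qed.

Variable ev : 'I_n -> event T0.
Hypothesis evP : forall p : 'I_n,
  [/\ P p = ev_before (ev p), P p.+1 = ev_after (ev p),
    sweeps T (gamma p) (gamma p.+1) (ev_tri (ev p)),
    ev_tri (ev p) \in triangles T &
    mx_entry (phi R T (gamma p) (gamma p.+1)) (code (nth [::] ws p))
      (code (nth [::] ws p.+1)) =
      ev_weight R (ev p)].

Lemma chain_before (p : 'I_n) : P p = ev_before (ev p). Proof. by case: (evP p). Qed.
Lemma chain_after (p : 'I_n) : P p.+1 = ev_after (ev p). Proof. by case: (evP p). Qed.
Lemma chain_tri p : ev_tri (ev p) \in triangles T. Proof. by case: (evP p). Qed.
Lemma chain_closed : P n = P 0. Proof. by rewrite /P gamma_loop ws_loop. Qed.

Lemma chain_tri_inj : injective (fun p => ev_tri (ev p)).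
Proof.
move=> p q E; have /eqP/cards1P[r rE] := once (chain_tri p).
have [_ _ sp _ _] := evP p; have [_ _ sq _ _] := evP q.
have : p \in [set r]%SET by rewrite -rE inE.
have : q \in [set r]%SET by rewrite -rE inE E.
by rewrite !inE => /eqP -> /eqP ->.
Qed.

Lemma chain_tri_surj t : t \in triangles T -> exists p, t = ev_tri (ev p).
Proof.
move=> tT; have /eqP/cards1P[r rE] := once tT; exists r.
have : r \in [set r]%SET by rewrite inE.
rewrite -rE inE => st; have [_ _ sr _ _] := evP r; exact: sweeps_uniq st sr.
Qed.

Lemma unzip1_chain p : (p <= n)%N -> unzip1 (P p) = arcs (gamma p).
Proof. by move=> pn; rewrite unzip1_zip // ws_size // size_arcs. Qed.

Lemma unzip2_chain p : (p <= n)%N -> unzip2 (P p) = nth [::] ws p.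
Proof. by move=> pn; rewrite unzip2_zip // ws_size // size_arcs. Qed.

Lemma chain_arc p a b k : (p <= n)%N -> (a, b, k) \in P p -> (a, b) \in arcs (gamma p).
Proof. by move=> pn dP; rewrite -unzip1_chain //; apply: (map_f fst dP). Qed.

Lemma chain_edge p a b k : (p <= n)%N -> (a, b, k) \in P p ->
  [set a; b]%SET \in edges T.
Proof. by move=> pn dP; apply: arc_edge (gamma_edge_path pn) (chain_arc pn dP). Qed.

Lemma chain_nohead (d : T0 * T0) : ~ forall p, (p <= n)%N ->
  exists k Q, P p = (d, k) :: Q.
Proof.
move=> H; case: nowhisker => /(_ d.1 d.2) /negP + _; apply;
  apply/(all_nthP [::]) => p pn.
have [k [Q PE]] := H p pn; have := unzip1_chain pn; rewrite PE /= -/(gamma p).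
case: (gamma p) => [|x [|y g]] //; rewrite /arcs /= => -[-> _] /=.
by rewrite !eqxx prefix0s.
Qed.

Lemma chain_nolast (d : T0 * T0) : ~ forall p, (p <= n)%N ->
  exists k Q, P p = rcons Q (d, k).
Proof.
move=> H; case: nowhisker => _ /(_ d.1 d.2) /negP; apply; apply/(all_nthP [::]) => p pn.
have [k [Q PE]] := H p pn; have := unzip1_chain pn; rewrite PE /unzip1 map_rcons /=.
by move=> E; apply: (@arcs_suffix _ _ (unzip1 Q)); rewrite -E; case: (d).
Qed.

Let chain_color := loop_color orT sphereT chain_before chain_after chain_closed
  chain_tri
  chain_tri_inj chain_tri_surj chain_edge chain_nohead chain_nolast.

Lemma coloring_of_chain : exists u : coloring,
  forall p, (p <= n)%N -> nth [::] ws p = [seq arc_color u d | d <- arcs (gamma p)].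
Proof.
pose has_col (e : {set T0}) k := exists p a b,
  [/\ (p <= n)%N, (a, b, k) \in P p & e = [set a; b]%SET].
pose u : coloring := [ffun e => odflt ord0 [pick k | `[< has_col (val e) k >]]].
exists u => p pn; rewrite -unzip2_chain // -unzip1_chain // /unzip1 -map_comp.
apply/eq_in_map => -[[a b] k] dP /=; have eT := chain_edge pn dP.
rewrite /arc_color /= insubT ffunE;
  case: pickP => [k' /asboolP[p' [a' [b' [pn' dP' E]]]]|none].
  exact: (chain_color pn pn' dP dP' E).
by have /asboolP[] := none k; exists p, a, b.
Qed.

Lemma chain_weight_coloring (u : coloring) :
  (forall p, (p <= n)%N -> nth [::] ws p = [seq arc_color u d | d <- arcs (gamma p)]) ->
  chain_weight R T (gamma0 :: s) ws =
    \prod_(t in triangles T) triangle_weight R pos u t.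
Proof.
move=> wsE; have col p a b k : (p <= n)%N -> (a, b, k) \in P p ->
  k = arc_color u (a, b).
  move=> pn; rewrite /P /carcs wsE //.
  have -> : zip (arcs (gamma p)) [seq arc_color u d | d <- arcs (gamma p)] =
            [seq (d, arc_color u d) | d <- arcs (gamma p)].
    by elim: (arcs _) => //= d l ->.
  by move=> /mapP[d _ [<- ->]].
have wE p : ev_weight R (ev p) =
  (-1) ^+ (~~ coherent pos (ev p)) * triangle_weight R pos u (ev_tri (ev p)).
  have in_col d : d \in ev_before (ev p) \/ d \in ev_after (ev p) ->
    d.2 = arc_color u d.1.
    rewrite -chain_before -chain_after; case: d => [[a b] k] [] dP /=.
      exact: (col p) (ltnW (ltn_ord p)) dP.
    exact: (col p.+1) (ltn_ord p) dP.
  have in_col' d : d \in ev_arcs (ev p) -> d.2 = arc_color u d.1.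
    by move=> /ev_arcs_sides/orP; apply: in_col.
  apply: (@ev_weightE R T0 T pos orT u (ev p)); first exact: chain_tri.
  - by apply: (in_col' (_, _, ev_b (ev p))); rewrite !inE eqxx.
  - by apply: (in_col' (_, _, ev_c (ev p))); rewrite !inE eqxx orbT.
  - by apply: (in_col' (_, _, ev_a (ev p))); rewrite !inE eqxx !orbT.
rewrite /chain_weight /=;
  under eq_bigr => p _ do [have [_ _ _ _ ->] := evP p; rewrite wE].
rewrite big_split /= (prod_sign orT chain_before chain_after chain_closed chain_tri
  chain_tri_inj) mul1r.
have -> : triangles T = [set ev_tri (ev p) | p in 'I_n]%SET.
  apply/setP => t; apply/idP/imsetP => [/chain_tri_surj[p ->]|[p _ ->]];
    first by exists p.
  exact: chain_tri.
by rewrite big_imset //=; move=> p q _ _; apply: chain_tri_inj.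
Qed.

End Chain.

Definition coloring_chain (u : coloring) :=
  [seq [seq arc_color u d | d <- arcs g] | g <- gamma0 :: s].

Lemma nth_coloring_chain u p : (p <= n)%N ->
  nth [::] (coloring_chain u) p = [seq arc_color u d | d <- arcs (gamma p)].
Proof. by move=> pn; rewrite /coloring_chain (nth_map [::]). Qed.

Lemma size_coloring_chain u p : (p <= n)%N ->
  size (nth [::] (coloring_chain u) p) = plength (gamma p).
Proof. by move=> pn; rewrite nth_coloring_chain // size_map size_arcs. Qed.

Lemma coloring_chain_loop u : nth [::] (coloring_chain u) n =
  nth [::] (coloring_chain u) 0.
Proof. by rewrite !nth_coloring_chain // gamma_loop. Qed.

Lemma coloring_chain_comp u (p : 'I_n) :
  compatible R T (gamma p) (gamma p.+1) (nth [::] (coloring_chain u) p)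
    (nth [::] (coloring_chain u) p.+1).
Proof.
right; exists (arc_color u); rewrite !nth_coloring_chain //; exact: ltnW.
Qed.

Lemma coloring_chain_weight u :
  chain_weight R T (gamma0 :: s) (coloring_chain u) =
    \prod_(t in triangles T) triangle_weight R pos u t.
Proof.
have [ev evP] := chain_events (size_coloring_chain u) (@coloring_chain_comp u).
exact: (chain_weight_coloring (coloring_chain_loop u) evP (@nth_coloring_chain u)).
Qed.

(** The triangle containing e is swept, and each of its sides lies on the path
before or after that step. The events come from an arbitrary coloring. *)
Lemma edge_on_path e : e \in edges T -> exists p a b,
  [/\ (p <= n)%N, (a, b) \in arcs (gamma p) & e = [set a; b]%SET].
Proof.
move=> eT; have [t tT et] := edge_in_triangle sphereT eT.
have /eqP/cards2P[a [b [ab eE]]] : #|e| = 2%N by apply: card_edge eT.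
pose u : coloring := [ffun=> ord0].
have [ev evP] := chain_events (size_coloring_chain u) (@coloring_chain_comp u).
have [p tE] := chain_tri_surj evP tT; rewrite {}tE eE in et.
have [k dr] := rim_edge orT (chain_tri evP p) ab et.
have [x [y [xyE dm]]] : exists x y, e = [set x; y]%SET /\ (x, y, k) \in ev_arcs (ev p).
  by case: dr => /rim_ev_arcs [] dm; [exists a, b|exists b, a|exists b, a|exists a, b];
    rewrite eE //; split=> //; rewrite finset.setUC.
have /orP[dP|dP] : ((x, y, k) \in carcs (gamma p) (nth [::] (coloring_chain u) p)) ||
    ((x, y, k) \in carcs (gamma p.+1) (nth [::] (coloring_chain u) p.+1)).
  by have [-> -> _ _ _] := evP p; apply: ev_arcs_sides.
- exists p, x, y; split=> //; first exact: ltnW.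
  exact: (chain_arc (size_coloring_chain u) (ltnW (ltn_ord p)) dP).
exists p.+1, x, y; split=> //;
  exact: (chain_arc (size_coloring_chain u) (ltn_ord p) dP).
Qed.

Lemma coloring_chain_inj : injective coloring_chain.
Proof.
move=> u v E; apply/ffunP => -[e eT].
have [p [a [b [pn ab eE]]]] := edge_on_path eT.
have := congr1 (fun ws => nth [::] ws p) E;
  rewrite !nth_coloring_chain // => /eq_in_map /(_ _ ab).
by subst e; rewrite /arc_color /= !insubT.
Qed.

Lemma state_sum :
  \sum_(ws <- chains (gamma0 :: s) | last [::] ws == head [::] ws) chain_weight R T
    (gamma0 :: s) ws
  = chromatic_index R T pos.
Proof.
transitivity (\sum_(ws <- [seq coloring_chain u | u <- enum coloring])
    chain_weight R T (gamma0 :: s) ws); last first.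
  by rewrite big_map big_enum; apply: eq_bigr => u _; apply: coloring_chain_weight.
pose nz ws := chain_weight R T (gamma0 :: s) ws != 0.
have drop_zeros (r : seq (seq (seq 'I_3))) (Q : pred (seq (seq 'I_3))) :
    \sum_(ws <- r | Q ws) chain_weight R T (gamma0 :: s) ws =
    \sum_(ws <- [seq ws <- r | Q ws && nz ws]) chain_weight R T (gamma0 :: s) ws.
  rewrite big_filter big_mkcond [RHS]big_mkcond; apply: eq_bigr => ws _.
  by rewrite /nz; case: (Q ws) => //=; case: eqP.
(* Colorings may have weight zero too, so zero terms are removed on both sides. *)
rewrite drop_zeros [RHS]drop_zeros; apply/perm_big/uniq_perm.
- exact/filter_uniq/chains_uniq.
- by apply: filter_uniq; rewrite map_inj_uniq ?enum_uniq //; apply: coloring_chain_inj.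
move=> ws; rewrite !mem_filter mem_chains.
case nzws: (nz ws); rewrite /= ?andbF ?andbT //=.
rewrite andbC; apply/andP/mapP => [[/eqP szs /eqP lh]|[u _ ->]]; last first.
  split; last first.
    apply/eqP; have := coloring_chain_loop u; rewrite -nth_last nth0 => <-.
    by rewrite /coloring_chain size_map.
  by rewrite /coloring_chain -map_comp; apply/eqP/eq_map => g /=;
    rewrite size_map size_arcs.
have sws : size ws = n.+1 by have := congr1 size szs; rewrite /= !size_map.
have ws_size p : (p <= n)%N -> size (nth [::] ws p) = plength (gamma p).
  have szs' : map size ws = map (@plength T0) (gamma0 :: s) by [].
  by move=> pn; rewrite -(nth_map [::] 0%N size) ?sws // szs' (nth_map [::]).
have ws_loop : nth [::] ws n = nth [::] ws 0 by rewrite nth0 -lh -nth_last sws.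
have ws_comp (p : 'I_n) :
    compatible R T (gamma p) (gamma p.+1) (nth [::] ws p) (nth [::] ws p.+1).
  by left; move: nzws; rewrite /nz /chain_weight => /prodf_neq0 /(_ p isT).
have [ev evP] := chain_events ws_size ws_comp.
have [u uP] := coloring_of_chain ws_size ws_loop evP.
exists u; first by rewrite mem_enum.
apply: (@eq_from_nth _ [::]); first by rewrite sws /coloring_chain size_map.
by move=> p; rewrite sws => pn; rewrite nth_coloring_chain // uP.
Qed.
End Main.

Theorem theorem2 (R : realType) (T0 : finType) (T : tricomplex T0)
    (sphereT : triangulates_sphere R T)
    (pos : T0 -> T0 -> T0 -> bool) (orT : is_orientation T pos)
    (gamma0 : seq T0) (s : seq (seq T0))
    (path2 : two_path T gamma0 s) (loop : last gamma0 s = gamma0)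
    (once : sweeps_each_triangle_once T gamma0 s)
    (nowhisker : whiskerless gamma0 s) :
  \tr (holonomy R T loop) = chromatic_index R T pos.
Proof. by rewrite trace_holonomy; apply: state_sum. Qed.
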